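(* There is an absolute constant $C>0$ such that for every $n\ge 2$ and every Boolean function $f:\{0,1\}^n\times\{0,1\}^n\to\{0,1\}$, $$Q^{\parallel}(f)\le C\cdot 2^{8\,Q^{ent}(f)}\log n .$$
   Context: All protocols compute $f$ with error probability at most $1/3$ on every input. $Q^{\parallel}(f)$ is the minimal total number of qubits communicated in a quantum simultaneous-message-passing (SMP) protocol for $f$ with no shared randomness and no shared entanglement: Alice (holding $x$) and Bob (holding $y$) each send one quantum message to a referee who holds no input and outputs the answer. $Q^{ent}(f)$ is the minimal number of qubits communicated in an arbitrary (multi-round, interactive) two-party quantum protocol between Alice and Bob computing $f$, where Alice and Bob may start with an arbitrary shared entangled state of unlimited size (not counted in the cost). *)

(* Defs.v *)
From HB Require Import structures.
From mathcomp Require Import all_boot all_order all_algebra.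
From mathcomp Require Import complex Rstruct.
From Stdlib Require Rpower.

Set Implicit Arguments.
Unset Strict Implicit.
Unset Printing Implicit Defensive.

Import Order.TTheory GRing.Theory Num.Theory.
Local Open Scope ring_scope.

Definition RR : rcfType := Rdefinitions.R.
Definition CC : numClosedFieldType := RR[i].

Definition input (n : nat) := {ffun 'I_n -> bool}.

(** A system of N qubits (labelled by 'I_N).  Computational basis states are
    the bit assignments; pure states and operators are given by their
    coordinates / matrix entries in the computational basis. *)
Definition basis (N : nat) := {ffun 'I_N -> bool}.
Definition vec (N : nat) := basis N -> CC.
Definition op (N : nat) := basis N -> basis N -> CC.

Definition applyop N (K : op N) (v : vec N) : vec N :=
  fun x => \sum_(y : basis N) K x y * v y.

Definition unit_vec N (v : vec N) : Prop := \sum_(x : basis N) `|v x| ^+ 2 = 1.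

(** K^dagger K = I (equivalent to unitarity in finite dimension) *)
Definition unitary N (K : op N) : Prop :=
  forall y z : basis N, \sum_(x : basis N) (K x y)^* * K x z = (y == z)%:R.

Definition agree_off N (S : {set 'I_N}) (x y : basis N) : bool :=
  [forall i, (i \notin S) ==> (x i == y i)].

Definition proj N (S : {set 'I_N}) (x : basis N) : basis N :=
  [ffun i => (i \in S) && x i].

(** K is of the form U (x) Id, with U acting on the qubits in S only *)
Definition acts_on N (S : {set 'I_N}) (K : op N) : Prop :=
  exists u : basis N -> basis N -> CC,
    forall x y, K x y = (agree_off S x y)%:R * u (proj S x) (proj S y).

(** v is a state of the qubits in S (all other qubits are |0>) *)
Definition supported_on N (S : {set 'I_N}) (v : vec N) : Prop :=
  forall x, x != proj S x -> v x = 0.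

Definition prob_one N (v : vec N) (o : 'I_N) : CC :=
  \sum_(x : basis N | x o) `|v x| ^+ 2.

Definition computes n (f : input n -> input n -> bool)
  (acc : input n -> input n -> CC) : Prop :=
  forall x y, if f x y then 2%:R / 3%:R <= acc x y else acc x y <= 1 / 3%:R.

(** * Interactive two-party protocols with prior shared entanglement.
    Every qubit is held by Alice or by Bob.  Initially the N qubits are in
    an arbitrary (input-independent) state psi0 -- this contains the shared
    entangled state of arbitrary size and the private workspaces.  In each
    round one party applies a unitary (depending on its own input) to the
    qubits it currently holds, and then sends a set of qubits it holds to
    the other party.  Finally qubit [e_out] is measured (by its holder).
    The cost is the total number of qubits sent. *)

Record round (n N : nat) := Round {
  r_alice : bool;
  r_op : input n -> op N;
  r_send : {set 'I_N} }.
Arguments r_op {n N} r _ _ _ : rename.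

Record ent_protocol (n : nat) := EntProt {
  e_N : nat;
  e_ownA0 : {set 'I_e_N};
  e_psi0 : vec e_N;
  e_rounds : seq (round n e_N);
  e_out : 'I_e_N }.
Arguments e_psi0 {n} P _ : rename.

Definition next_ownA n N (ownA : {set 'I_N}) (r : round n N) : {set 'I_N} :=
  if r_alice r then ownA :\: r_send r else ownA :|: r_send r.

Fixpoint rounds_valid n N (ownA : {set 'I_N}) (rs : seq (round n N)) : Prop :=
  match rs with
  | [::] => True
  | r :: rs' =>
      let own := if r_alice r then ownA else ~: ownA in
      [/\ forall z : input n, unitary (r_op r z) /\ acts_on own (r_op r z),
          r_send r \subset own &
          rounds_valid (next_ownA ownA r) rs']
  end.

Fixpoint run n N (x y : input n) (rs : seq (round n N)) (v : vec N) : vec N :=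
  match rs with
  | [::] => v
  | r :: rs' => run x y rs' (applyop (r_op r (if r_alice r then x else y)) v)
  end.

Definition ent_valid n (P : ent_protocol n) : Prop :=
  unit_vec (e_psi0 P) /\ rounds_valid (e_ownA0 P) (e_rounds P).

Definition ent_cost n (P : ent_protocol n) : nat :=
  \sum_(r <- e_rounds P) #|r_send r|.

Definition ent_acc n (P : ent_protocol n) (x y : input n) : CC :=
  prob_one (run x y (e_rounds P) (e_psi0 P)) (e_out P).

(** * Quantum simultaneous-message-passing protocols, no shared randomness,
    no shared entanglement.  The referee's system has N qubits; Alice's
    message occupies the qubits in s_A, Bob's the qubits in s_B (disjoint),
    the remaining qubits are the referee's ancillas, initialised to |0>.
    Alice's message on input x is an arbitrary mixed state, given as a
    finite ensemble {(pA x a, psiA x a)} of pure states (private randomness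
    allowed); likewise for Bob.  The referee applies a unitary and measures
    qubit s_out.  Cost = #|s_A| + #|s_B|. *)

Record smp_protocol (n : nat) := SMP {
  s_N : nat;
  s_A : {set 'I_s_N};
  s_B : {set 'I_s_N};
  s_KA : nat;
  s_pA : input n -> 'I_s_KA -> CC;
  s_psiA : input n -> 'I_s_KA -> vec s_N;
  s_KB : nat;
  s_pB : input n -> 'I_s_KB -> CC;
  s_psiB : input n -> 'I_s_KB -> vec s_N;
  s_U : op s_N;
  s_out : 'I_s_N }.
Arguments s_psiA {n} S _ _ _ : rename.
Arguments s_psiB {n} S _ _ _ : rename.
Arguments s_U {n} S _ _ : rename.
Arguments s_pA {n} S _ _ : rename.
Arguments s_pB {n} S _ _ : rename.

(** the product state psi (x) phi (x) |0...0> *)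
Definition tensor N (A B : {set 'I_N}) (psi phi : vec N) : vec N :=
  fun z => psi (proj A z) * phi (proj B z) * (z == proj (A :|: B) z)%:R.

Definition smp_valid n (S : smp_protocol n) : Prop :=
  [/\ [disjoint s_A S & s_B S], unitary (s_U S) &
    [/\ forall x, (forall a, 0 <= s_pA S x a) /\ \sum_a s_pA S x a = 1,
      forall x a, unit_vec (s_psiA S x a) /\ supported_on (s_A S) (s_psiA S x a),
      forall y, (forall b, 0 <= s_pB S y b) /\ \sum_b s_pB S y b = 1
    & forall y b, unit_vec (s_psiB S y b) /\ supported_on (s_B S) (s_psiB S y b)]].

Definition smp_cost n (S : smp_protocol n) : nat := #|s_A S| + #|s_B S|.

Definition smp_acc n (S : smp_protocol n) (x y : input n) : CC :=
  \sum_a \sum_b s_pA S x a * s_pB S y b *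
     prob_one (applyop (s_U S)
                 (tensor (s_A S) (s_B S) (s_psiA S x a) (s_psiB S y b)))
              (s_out S).

Definition Qent_le n (f : input n -> input n -> bool) (c : nat) : Prop :=
  exists P : ent_protocol n, [/\ ent_valid P, computes f (ent_acc P) & (ent_cost P <= c)%N].

Definition Qpar_le n (f : input n -> input n -> bool) (c : RR) : Prop :=
  exists S : smp_protocol n, [/\ smp_valid S, computes f (smp_acc S) & (smp_cost S)%:R <= c].

(* Main.v *)
(** The proof goes through real vectors with a prescribed inner product.

    In the Heisenberg picture the output observable, pulled back through the rounds,
    stays a sum of products of a contraction on Alice's qubits and a contraction on
    Bob's.  Pulling it back through the transmission of one qubit multiplies the number
    of terms by 4, because an operator on that qubit and others is expanded in matrix
    units of the qubit.  Hence the acceptance probability is an inner product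
    <a_x, b_y> of vectors of squared norm at most 4^q, with q the communication.

    Random signs, truncation at height O(4^q) and sampling reduce the dimension to
    n 2^O(q) at the price of a small relative error; no sharp concentration is needed
    since only the logarithm of the dimension matters.  Normalized, the vectors become
    states on O(q + log n) qubits whose overlaps differ by Omega(4^-q) between 1-inputs
    and 0-inputs, and O(16^q) independent swap tests, analysed by Chebyshev's
    inequality, distinguish the two cases.  The cost O(16^q (q + log n)) is well below
    the bound claimed. *)

Require Import Defs.
From HB Require Import structures.
From mathcomp Require Import all_boot all_order all_algebra.
From mathcomp Require Import complex Rstruct.
From mathcomp Require Import ring lra zify.
From Stdlib Require Rpower.
Import Order.TTheory GRing.Theory Num.Theory.
Local Open Scope ring_scope.

Set Implicit Arguments.
Unset Strict Implicit.
Unset Printing Implicit Defensive.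

(** * Factorization of the acceptance probability *)

Definition toC (r : RR) : CC := real_complex RR r.

HB.instance Definition _ := GRing.RMorphism.copy toC (real_complex RR).

Lemma toC_le (r s : RR) : (toC r <= toC s) = (r <= s).
Proof. exact: lecR. Qed.

Lemma toC_real (r : RR) : toC r \is Num.real.
Proof. by rewrite realE -(rmorph0 toC) !toC_le -realE num_real. Qed.

Lemma toC_conj (r : RR) : (toC r)^* = toC r.
Proof. exact/CrealP/toC_real. Qed.

Lemma toC_normsq (r : RR) : `|toC r| ^+ 2 = toC (r ^+ 2).
Proof. by rewrite real_normK ?toC_real // rmorphXn. Qed.

Lemma toC_computes n (f : input n -> input n -> bool) acc (r : input n -> input n -> RR) :
  (forall x y, acc x y = toC (r x y)) ->
  (computes f acc <-> forall x y, if f x y then 2 / 3 <= r x y else r x y <= 1 / 3).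
Proof.
move=> h; have e (k : nat) : k%:R / 3%:R = toC (k%:R / 3).
  by rewrite fmorph_div /= !rmorph_nat.
have e1 := e 1%N; rewrite mulr1n in e1.
by split=> H x y; move: (H x y); rewrite h e e1 !toC_le.
Qed.

(** * Adjoints, inner products and contractions *)

Definition adjmx m n (A : 'M[CC]_(m, n)) : 'M[CC]_(n, m) := (map_mx Num.conj A)^T.

Lemma adjmxE m n (A : 'M[CC]_(m, n)) i j : adjmx A i j = (A j i)^*.
Proof. by rewrite !mxE. Qed.

Lemma adjmxK m n (A : 'M[CC]_(m, n)) : adjmx (adjmx A) = A.
Proof. by apply/matrixP => i j; rewrite !adjmxE conjCK. Qed.

Lemma adjmxM m n p (A : 'M[CC]_(m, n)) (B : 'M[CC]_(n, p)) :
  adjmx (A *m B) = adjmx B *m adjmx A.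
Proof. by rewrite /adjmx map_mxM trmx_mul. Qed.

Lemma adjmx_sum m n (I : finType) (A : I -> 'M[CC]_(m, n)) :
  adjmx (\sum_i A i) = \sum_i adjmx (A i).
Proof. by apply/matrixP => i j; rewrite adjmxE !summxE rmorph_sum; apply: eq_bigr => k _; rewrite adjmxE. Qed.

Lemma adjmxB m n (A B : 'M[CC]_(m, n)) : adjmx (A - B) = adjmx A - adjmx B.
Proof. by apply/matrixP => i j; rewrite !mxE rmorphB. Qed.

Lemma adjmx1 n : adjmx (1%:M : 'M[CC]_n) = 1%:M.
Proof. by rewrite /adjmx map_mx1 trmx1. Qed.

Definition dot n (u v : 'cV[CC]_n) : CC := (adjmx u *m v) ord0 ord0.

Lemma dotE n (u v : 'cV[CC]_n) : dot u v = \sum_i (u i ord0)^* * v i ord0.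
Proof. by rewrite /dot mxE; apply: eq_bigr => i _; rewrite adjmxE. Qed.

Lemma dot_ge0 n (u : 'cV[CC]_n) : 0 <= dot u u.
Proof. by rewrite dotE sumr_ge0 // => i _; rewrite mulrC -normCK exprn_ge0. Qed.

Lemma dot_adj m n (A : 'M[CC]_(m, n)) (u : 'cV[CC]_m) (v : 'cV[CC]_n) :
  dot u (A *m v) = dot (adjmx A *m u) v.
Proof. by rewrite /dot adjmxM adjmxK mulmxA. Qed.

Lemma dotBl n (u u' v : 'cV[CC]_n) : dot (u - u') v = dot u v - dot u' v.
Proof. by rewrite !dotE -sumrB; apply: eq_bigr => i _; rewrite !mxE rmorphB mulrBl. Qed.

Lemma dot_sumr n (I : finType) (u : 'cV[CC]_n) (v : I -> 'cV[CC]_n) :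
  dot u (\sum_i v i) = \sum_i dot u (v i).
Proof. by rewrite /dot mulmx_sumr summxE. Qed.

Definition contraction n (A : 'M[CC]_n) := forall v, dot (A *m v) (A *m v) <= dot v v.

Lemma contractionM n (A B : 'M[CC]_n) : contraction A -> contraction B -> contraction (A *m B).
Proof. by move=> hA hB v; rewrite -mulmxA (le_trans (hA _)). Qed.

Lemma contraction_isometry n (A : 'M[CC]_n) : adjmx A *m A = 1%:M -> contraction A.
Proof. by move=> hA v; rewrite dot_adj mulmxA hA mul1mx. Qed.

(** The complement [Q] of the projector [P] is again a projector, and [dot v v] exceeds the squared
    norm of [E *m v] by that of [Q *m v]. *)
Lemma contraction_partial_isometry n (P E : 'M[CC]_n) :
  adjmx P = P -> P *m P = P -> adjmx E *m E = P -> contraction E.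
Proof.
move=> hP PP hE v; rewrite dot_adj mulmxA hE.
set Q := 1%:M - P; have hQ : adjmx Q = Q by rewrite adjmxB adjmx1 hP.
have QQ : Q *m Q = Q by rewrite mulmxBl mul1mx mulmxBr mulmx1 PP subrr subr0.
have := dot_ge0 (Q *m v); rewrite dot_adj hQ mulmxA QQ mulmxBl mul1mx.
by rewrite dotBl subr_ge0.
Qed.

(** * Operators on qubits as matrices, and their locality *)

Definition mx_of_op N (K : op N) : 'M[CC]_#|basis N| :=
  \matrix_(i, j) K (enum_val i) (enum_val j).

Definition cv_of_vec N (v : vec N) : 'cV[CC]_#|basis N| := \col_i v (enum_val i).

Definition opmul N (K L : op N) : op N := fun x z => \sum_y K x y * L y z.

Lemma sum_enum_val N (F : basis N -> CC) : \sum_(i < #|basis N|) F (enum_val i) = \sum_x F x.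
Proof. by rewrite -(big_enum_val F). Qed.

Lemma mx_of_opM N (K L : op N) : mx_of_op K *m mx_of_op L = mx_of_op (opmul K L).
Proof.
apply/matrixP => i j; rewrite !mxE /opmul -sum_enum_val.
by apply: eq_bigr => k _; rewrite !mxE.
Qed.

Lemma eq_mx_of_op N (K L : op N) : (forall x y, K x y = L x y) -> mx_of_op K = mx_of_op L.
Proof. by move=> e; apply/matrixP => i j; rewrite !mxE. Qed.

Lemma cv_of_applyop N (K : op N) (v : vec N) :
  cv_of_vec (applyop K v) = mx_of_op K *m cv_of_vec v.
Proof.
apply/matrixP => i j; rewrite !mxE /applyop -sum_enum_val.
by apply: eq_bigr => k _; rewrite !mxE.
Qed.

Lemma adjmx_of_op N (K : op N) : adjmx (mx_of_op K) = mx_of_op (fun x y => (K y x)^*).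
Proof. by apply/matrixP => i j; rewrite adjmxE !mxE. Qed.

Lemma unitary_adjmx N (K : op N) : unitary K -> adjmx (mx_of_op K) *m mx_of_op K = 1%:M.
Proof.
move=> hK; rewrite adjmx_of_op mx_of_opM; apply/matrixP => i j.
by rewrite !mxE /opmul hK (inj_eq enum_val_inj).
Qed.

Lemma acts_on_adj N (S : {set 'I_N}) (K : op N) :
  acts_on S K -> acts_on S (fun x y => (K y x)^*).
Proof.
move=> [u hu]; exists (fun x y => (u y x)^*) => x y; rewrite hu rmorphM rmorph_nat.
by congr ((nat_of_bool _)%:R * _); apply: eq_forallb => i; rewrite eq_sym.
Qed.

Lemma agree_offP N (S : {set 'I_N}) (x y : basis N) :
  reflect (forall i, i \notin S -> x i = y i) (agree_off S x y).
Proof.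
apply: (iffP forallP) => h i; first by move/(implyP (h i))/eqP.
by apply/implyP => /h/eqP.
Qed.

Lemma acts_on_subset N (S T : {set 'I_N}) (K : op N) :
  S \subset T -> acts_on S K -> acts_on T K.
Proof.
move=> /subsetP ST [u hu].
exists (fun x y => (agree_off S x y)%:R * u (proj S x) (proj S y)) => x y; rewrite hu.
have pp z : proj S (proj T z) = proj S z.
  by apply/ffunP => i; rewrite !ffunE; case: (boolP (i \in S)) => //= /ST->.
rewrite !pp mulrA -natrM mulnb; congr ((nat_of_bool _)%:R * _).
apply/agree_offP/andP => [h|[/agree_offP hT /agree_offP hS] i iS].
  split; apply/agree_offP => i hi; first by apply: h; apply: contraNN hi => /ST.
  by rewrite !ffunE h.
case: (boolP (i \in T)) => iT; last exact: hT.
by have := hS i iS; rewrite !ffunE iT.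
Qed.

Definition mix N (S : {set 'I_N}) (x y : basis N) : basis N :=
  [ffun i => if i \in S then x i else y i].

(** A contributing intermediate [y] agrees with [x] off [S] and with [z] off [T]; as the sets are
    disjoint, it can only be [mix S z x]. The formula obtained is symmetric in the two operators,
    whence [acts_on_comm]. *)
Lemma opmul_disjoint N (S T : {set 'I_N}) (K L : op N) (u v : basis N -> basis N -> CC) :
  [disjoint S & T] ->
  (forall x y, K x y = (agree_off S x y)%:R * u (proj S x) (proj S y)) ->
  (forall x y, L x y = (agree_off T x y)%:R * v (proj T x) (proj T y)) ->
  forall x z, opmul K L x z =
    (agree_off (S :|: T) x z)%:R * (u (proj S x) (proj S z) * v (proj T x) (proj T z)).
Proof.
move=> dST hK hL x z; rewrite /opmul.
have ST i : i \in T -> i \notin S by move=> iT; apply/negP => /(disjointFr dST); rewrite iT.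
rewrite (bigD1 (mix S z x)) //= big1 ?addr0 => [|y hy]; last first.
  rewrite hK hL; case: agree_offP => [h1|]; last by rewrite !mul0r.
  case: agree_offP => [h2|]; last by rewrite mul0r mulr0.
  case/negP: hy; apply/eqP/ffunP => i; rewrite ffunE.
  case: (boolP (i \in S)) => iS; last by rewrite h1.
  by apply: h2; apply/negP => /ST; rewrite iS.
have pS : proj S (mix S z x) = proj S z.
  by apply/ffunP => i; rewrite !ffunE; case: (i \in S).
have pT : proj T (mix S z x) = proj T x.
  by apply/ffunP => i; rewrite !ffunE; case: (boolP (i \in T)) => //= /ST/negPf->.
rewrite hK hL pS pT.
have -> : agree_off S x (mix S z x).
  by apply/agree_offP => i /negPf iS; rewrite ffunE iS.
rewrite mul1r mulrCA; congr ((nat_of_bool _)%:R * _).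
apply/agree_offP/agree_offP => h i.
  by rewrite inE negb_or => /andP[/negPf iS /h]; rewrite ffunE iS.
move=> iT; rewrite ffunE; case: (boolP (i \in S)) => // iS; apply: h.
by rewrite inE negb_or iS.
Qed.

Lemma acts_on_comm N (S T : {set 'I_N}) (K L : op N) :
  [disjoint S & T] -> acts_on S K -> acts_on T L ->
  mx_of_op K *m mx_of_op L = mx_of_op L *m mx_of_op K.
Proof.
move=> dST [u hu] [v hv]; rewrite !mx_of_opM; apply: eq_mx_of_op => x z.
rewrite (opmul_disjoint dST hu hv) (opmul_disjoint _ hv hu) 1?disjoint_sym //.
by rewrite setUC [u _ _ * _]mulrC.
Qed.

(** * Matrix units of a single qubit *)

Definition upd N (x : basis N) (i : 'I_N) (b : bool) : basis N :=
  [ffun j => if j == i then b else x j].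

(** The matrix unit |b><b'| on qubit [i], tensored with the identity on the other qubits. *)
Definition qunit_op N (i : 'I_N) (b b' : bool) : op N := fun x y =>
  (agree_off [set i] x y)%:R * ((x i == b) && (y i == b'))%:R.

Definition qunit N (i : 'I_N) (b b' : bool) := mx_of_op (qunit_op i b b').

Lemma qunit_opE N (i : 'I_N) b b' x y :
  qunit_op i b b' x y = ((x i == b) && (y == upd x i b'))%:R.
Proof.
rewrite /qunit_op -natrM mulnb; congr (nat_of_bool _)%:R.
apply/andP/andP => [[/agree_offP h /andP[-> /eqP yi]]|[-> /eqP->]]; split=> //.
- apply/eqP/ffunP => j; rewrite ffunE; case: eqVneq => [->//|ji].
  by rewrite -h // inE.
- by apply/agree_offP => j; rewrite inE ffunE => /negPf->.
- by rewrite ffunE !eqxx.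
Qed.

Lemma acts_on_qunit N (i : 'I_N) b b' : acts_on [set i] (qunit_op i b b').
Proof.
exists (fun x y => ((x i == b) && (y i == b'))%:R) => x y.
by rewrite !ffunE inE eqxx.
Qed.

Lemma updK N (x : basis N) i b c : upd (upd x i b) i c = upd x i c.
Proof. by apply/ffunP => j; rewrite !ffunE; case: eqP. Qed.

Lemma upd_id N (x : basis N) i : upd x i (x i) = x.
Proof. by apply/ffunP => j; rewrite !ffunE; case: eqP => // ->. Qed.

Lemma qunit_mull N (i : 'I_N) b b' (L : op N) x z :
  opmul (qunit_op i b b') L x z = (x i == b)%:R * L (upd x i b') z.
Proof.
rewrite /opmul (bigD1 (upd x i b')) //= qunit_opE eqxx andbT big1 ?addr0 // => y /negPf hy.
by rewrite qunit_opE hy andbF mul0r.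
Qed.

Lemma qunit_adj N (i : 'I_N) b b' : adjmx (qunit i b b') = qunit i b' b.
Proof.
rewrite adjmx_of_op; apply: eq_mx_of_op => x y; rewrite /qunit_op rmorphM !rmorph_nat andbC.
by congr ((nat_of_bool _)%:R * _); apply: eq_forallb => j; rewrite eq_sym.
Qed.

Lemma qunit_mulr N (i : 'I_N) b b' (L : op N) x z :
  opmul L (qunit_op i b b') x z = (z i == b')%:R * L x (upd z i b).
Proof.
have sym y : qunit_op i b b' y z = qunit_op i b' b z y.
  rewrite /qunit_op andbC; congr ((nat_of_bool _)%:R * _).
  by apply: eq_forallb => j; rewrite eq_sym.
rewrite /opmul (bigD1 (upd z i b)) //= sym qunit_opE eqxx andbT mulrC big1 ?addr0 // => y /negPf hy.
by rewrite sym qunit_opE hy andbF mulr0.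
Qed.

Lemma qunitM N (i : 'I_N) b b' c c' :
  qunit i b b' *m qunit i c c' = if b' == c then qunit i b c' else 0.
Proof.
rewrite mx_of_opM; case: eqVneq => [<-|bc].
  apply: eq_mx_of_op => x z; rewrite qunit_mull !qunit_opE ffunE eqxx updK eqxx /=.
  by rewrite -natrM mulnb.
apply/matrixP => j k; rewrite !mxE qunit_mull qunit_opE ffunE eqxx (negPf bc).
by rewrite mulr0.
Qed.

Lemma qunit_sum1 N (i : 'I_N) : \sum_b qunit i b b = 1%:M.
Proof.
apply/matrixP => j k; rewrite summxE mxE -(inj_eq enum_val_inj).
set x := enum_val j; set y := enum_val k.
rewrite (bigD1 (x i)) //= mxE -/x -/y qunit_opE upd_id eqxx big1 ?addr0 1?eq_sym // => b /negPf hb.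
by rewrite mxE -/x qunit_opE eq_sym hb.
Qed.

(** The block of [M] at position [(b, b')] with respect to qubit [i]; the sum over [c] tensors this
    block with the identity on that qubit. *)
Definition slice N (i : 'I_N) b b' (M : 'M[CC]_#|basis N|) :=
  \sum_c qunit i c b *m M *m qunit i b' c.

Lemma sum_slice N (i : 'I_N) (M : 'M[CC]_#|basis N|) :
  \sum_b \sum_b' qunit i b b' *m slice i b b' M = M.
Proof.
transitivity (\sum_b \sum_b' qunit i b b *m M *m qunit i b' b').
  apply: eq_bigr => b _; apply: eq_bigr => b' _.
  rewrite /slice mulmx_sumr (bigD1 b') //= big1 ?addr0 => [|c /negPf hc].
    by rewrite !mulmxA qunitM eqxx.
  by rewrite !mulmxA qunitM eq_sym hc !mul0mx.
by under eq_bigr do rewrite -mulmx_sumr qunit_sum1 mulmx1; rewrite -mulmx_suml qunit_sum1 mul1mx.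
Qed.

(** Both sides equal [qunit i d b *m M *m qunit i b' e]. *)
Lemma slice_qunit N (i : 'I_N) b b' d e (M : 'M[CC]_#|basis N|) :
  slice i b b' M *m qunit i d e = qunit i d e *m slice i b b' M.
Proof.
transitivity (qunit i d b *m M *m qunit i b' e).
  rewrite /slice mulmx_suml (bigD1 d) //= big1 ?addr0 => [|c /negPf hc].
    by rewrite -[_ *m qunit i d e]mulmxA qunitM eqxx.
  by rewrite -mulmxA qunitM hc mulmx0.
rewrite /slice mulmx_sumr (bigD1 e) //= big1 ?addr0 => [|c /negPf hc].
  by rewrite !mulmxA qunitM eqxx.
by rewrite !mulmxA qunitM eq_sym hc !mul0mx.
Qed.

Lemma contraction_qunit N (i : 'I_N) b b' : contraction (qunit i b b').
Proof.
apply: (@contraction_partial_isometry _ (qunit i b' b')); rewrite ?qunit_adj ?qunitM ?eqxx //.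
Qed.

(** Squared norms are split according to the value [c] of qubit [i]. On each component the slice
    acts as [M] between two matrix units, and [qunit i b' c] preserves the norm of the component
    [c]. *)
Lemma contraction_slice N (i : 'I_N) b b' (M : 'M[CC]_#|basis N|) :
  contraction M -> contraction (slice i b b' M).
Proof.
move=> hM v.
have resolve u : dot u u = \sum_c dot (qunit i c c *m u) (qunit i c c *m u).
  under eq_bigr do rewrite dot_adj qunit_adj mulmxA qunitM eqxx -qunit_adj -dot_adj.
  by rewrite -dot_sumr -mulmx_suml qunit_sum1 mul1mx.
rewrite [leLHS]resolve [leRHS]resolve; apply: ler_sum => c _.
have -> : qunit i c c *m (slice i b b' M *m v) = qunit i c b *m (M *m (qunit i b' c *m v)).
  rewrite mulmxA /slice mulmx_sumr (bigD1 c) //= big1 ?addr0 => [|e /negPf he].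
    by rewrite !mulmxA qunitM eqxx.
  by rewrite !mulmxA qunitM eq_sym he !mul0mx.
apply: le_trans (contraction_qunit _ _ _ _) _; apply: le_trans (hM _) _.
by rewrite dot_adj qunit_adj mulmxA qunitM eqxx -{1}(qunit_adj i c c) dot_adj qunit_adj mulmxA qunitM eqxx.
Qed.

(** * Sums of products of local contractions *)

Definition commutes_with N (T : {set 'I_N}) (M : 'M[CC]_#|basis N|) :=
  forall L, acts_on T L -> M *m mx_of_op L = mx_of_op L *m M.

Lemma commutes_withM N (T : {set 'I_N}) (M M' : 'M[CC]_#|basis N|) :
  commutes_with T M -> commutes_with T M' -> commutes_with T (M *m M').
Proof. by move=> h h' L hL; rewrite -mulmxA h' // !mulmxA h. Qed.

Lemma commutes_with_adj N (T : {set 'I_N}) (M : 'M[CC]_#|basis N|) :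
  commutes_with T M -> commutes_with T (adjmx M).
Proof.
move=> h L hL; have e := h _ (acts_on_adj hL).
by rewrite -adjmx_of_op in e; rewrite -[mx_of_op L]adjmxK -!adjmxM e.
Qed.

Lemma commutes_with_acts_on N (S : {set 'I_N}) (K : op N) :
  acts_on S K -> commutes_with (~: S) (mx_of_op K).
Proof. by move=> hK L hL; apply: acts_on_comm hK hL; rewrite -setI_eq0 setICr. Qed.

Lemma commutes_with_subset N (S T : {set 'I_N}) (M : 'M[CC]_#|basis N|) :
  S \subset T -> commutes_with T M -> commutes_with S M.
Proof. by move=> ST h L hL; apply: h; apply: acts_on_subset hL. Qed.

(** An operator [L] on [i |: S] is a sum of matrix units of qubit [i] times slices of [L]. The slice
    of [M] commutes with the former by [slice_qunit], and with the latter because they act on [S]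
    only. *)
Lemma commutes_with_slice N (S : {set 'I_N}) (i : 'I_N) b b' (M : 'M[CC]_#|basis N|) :
  i \notin S -> commutes_with S M -> commutes_with (i |: S) (slice i b b' M).
Proof.
move=> iS hM L [u hu]; have diS : [disjoint [set i] & S] by rewrite disjoints1.
rewrite -(sum_slice i (mx_of_op L)) mulmx_sumr mulmx_suml; apply: eq_bigr => d _.
rewrite mulmx_sumr mulmx_suml; apply: eq_bigr => d' _.
rewrite mulmxA slice_qunit -!mulmxA; congr (_ *m _).
(* These are the entries of the slice of [L]: fixing qubit [i] to [d] and [d'] leaves an operator on
   [S]. *)
pose K : op N := fun x y => (x i == y i)%:R * L (upd x i d) (upd y i d').
have -> : slice i d d' (mx_of_op L) = mx_of_op K.
  rewrite /slice; under eq_bigr do rewrite !mx_of_opM.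
  apply/matrixP => j k; rewrite summxE mxE; set x := enum_val j; set y := enum_val k.
  rewrite (bigD1 (x i)) //= mxE qunit_mulr qunit_mull -/x -/y eqxx mul1r [y i == _]eq_sym.
  by rewrite big1 ?addr0 // => c /negPf hc; rewrite mxE qunit_mulr qunit_mull -/x [x i == c]eq_sym hc mul0r mulr0.
have aK : acts_on S K.
  exists (fun x y => u (upd x i d) (upd y i d')) => x y; rewrite /K hu mulrA -natrM mulnb.
  have pp z c : proj (i |: S) (upd z i c) = upd (proj S z) i c.
    by apply/ffunP => j; rewrite !ffunE !inE; case: eqP.
  rewrite !pp; congr ((nat_of_bool _)%:R * _).
  apply/andP/agree_offP => [[/eqP xy /agree_offP h] j jS|h].
    case: (eqVneq j i) => [->//|ji]; have := h j.
    by rewrite !inE (negPf ji) !ffunE (negPf ji); apply.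
  rewrite h //; split=> //; apply/agree_offP => j; rewrite !inE negb_or => /andP[ji jS].
  by rewrite !ffunE (negPf ji) h.
rewrite /slice mulmx_suml mulmx_sumr; apply: eq_bigr => c _.
have cE e e' : qunit i e e' *m mx_of_op K = mx_of_op K *m qunit i e e'.
  exact: acts_on_comm diS (acts_on_qunit _ _ _) aK.
by rewrite -mulmxA cE mulmxA -[qunit i c b *m M *m _]mulmxA hM // !mulmxA cE.
Qed.

(* Locality of [A] and [B] is expressed by commutation with the operators of the other party. *)
Definition factored (X Y : Type) N (S : {set 'I_N}) (r : nat)
    (M : X -> Y -> 'M[CC]_#|basis N|) : Prop :=
  exists (J : finType) (A : X -> J -> 'M[CC]_#|basis N|) (B : Y -> J -> 'M[CC]_#|basis N|),
  [/\ #|J| = r,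
      forall x j, commutes_with (~: S) (A x j) /\ contraction (A x j),
      forall y j, commutes_with S (B y j) /\ contraction (B y j) &
      forall x y, M x y = \sum_j adjmx (A x j) *m B y j].

(** Taking adjoints exchanges the two parties, so each statement about Bob follows from the one
    about Alice. *)
Lemma factored_sym (X Y : Type) N (S : {set 'I_N}) r (M : X -> Y -> 'M[CC]_#|basis N|) :
  factored S r M -> factored (~: S) r (fun y x => adjmx (M x y)).
Proof.
move=> [J [A [B [hJ hA hB hM]]]]; exists J, B, A; split=> //; first by rewrite setCK.
by move=> y x; rewrite hM adjmx_sum; apply: eq_bigr => j _; rewrite adjmxM adjmxK.
Qed.

Lemma eq_factored (X Y : Type) N (S : {set 'I_N}) r (M M' : X -> Y -> 'M[CC]_#|basis N|) :
  (forall x y, M x y = M' x y) -> factored S r M -> factored S r M'.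
Proof. by move=> e [J [A [B [hJ hA hB hM]]]]; exists J, A, B; split=> // x y; rewrite -e. Qed.

(** The output measurement is local to the holder of qubit [i]; the other party contributes the
    identity. *)
Lemma factored_qunit (X Y : Type) N (S : {set 'I_N}) (i : 'I_N) (b : bool) :
  factored S 1 (fun (_ : X) (_ : Y) => qunit i b b).
Proof.
have c1 (T : {set 'I_N}) : commutes_with T 1%:M by move=> L _; rewrite mul1mx mulmx1.
have k1 : contraction (1%:M : 'M[CC]_#|basis N|) by move=> v; rewrite mul1mx.
have aux (X' Y' : Type) (T : {set 'I_N}) : i \in T -> factored T 1 (fun (_ : X') (_ : Y') => qunit i b b).
  move=> iT; exists unit, (fun _ _ => qunit i b b), (fun _ _ => 1%:M); split.
  - by rewrite card_unit.
  - split; last exact: contraction_qunit.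
    apply: (commutes_with_acts_on (acts_on_subset _ (acts_on_qunit i b b))).
    by rewrite sub1set.
  - by split.
  - by move=> x y; rewrite big_const card_unit /= addr0 qunit_adj mulmx1.
case: (boolP (i \in S)) => iS; first exact: aux.
rewrite -[S]setCK; apply: (@eq_factored _ _ _ _ _ (fun _ _ => adjmx (qunit i b b))).
  by move=> x y; rewrite qunit_adj.
by apply: factored_sym; apply: aux; rewrite inE.
Qed.

(** A unitary of Alice commutes with Bob's factors, so conjugating by it only conjugates Alice's
    factors, and no term is added. *)
Lemma factored_op (X Y : Type) N (S : {set 'I_N}) r (M : X -> Y -> 'M[CC]_#|basis N|)
    (U : X -> op N) :
  (forall x, unitary (U x) /\ acts_on S (U x)) -> factored S r M ->
  factored S r (fun x y => adjmx (mx_of_op (U x)) *m M x y *m mx_of_op (U x)).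
Proof.
move=> hU [J [A [B [hJ hA hB hM]]]].
exists J, (fun x j => adjmx (mx_of_op (U x)) *m A x j *m mx_of_op (U x)), B; split=> //.
- move=> x j; have [hu ha] := hU x; have [cA kA] := hA x j.
  have cU := commutes_with_acts_on ha; split.
    by do 2?apply: commutes_withM => //; apply: commutes_with_adj.
  have UU := unitary_adjmx hu.
  have kU := contraction_isometry UU.
  have kU' : contraction (adjmx (mx_of_op (U x))).
    by apply: contraction_isometry; rewrite adjmxK; apply: mulmx1C.
  exact: contractionM (contractionM kU' kA) kU.
- move=> x y; rewrite hM mulmx_sumr mulmx_suml; apply: eq_bigr => j _.
  have [_ ha] := hU x; have [cB _] := hB y j.
  by rewrite !adjmxM adjmxK -!mulmxA cB.
Qed.

Lemma factored_op_other (X Y : Type) N (S : {set 'I_N}) r (M : X -> Y -> 'M[CC]_#|basis N|)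
    (U : Y -> op N) :
  (forall y, unitary (U y) /\ acts_on (~: S) (U y)) -> factored S r M ->
  factored S r (fun x y => adjmx (mx_of_op (U y)) *m M x y *m mx_of_op (U y)).
Proof.
move=> hU /factored_sym /(factored_op hU) /factored_sym; rewrite setCK.
by apply: eq_factored => x y; rewrite !adjmxM !adjmxK mulmxA.
Qed.

(** Alice's qubits before she sends qubit [i] are those after it together with [i]. Each factor of
    Bob is expanded by [sum_slice]: the matrix units join Alice's factors, the slices no longer
    touch qubit [i], and the four pairs of bits multiply the number of terms. *)
Lemma factored_move1 (X Y : Type) N (S : {set 'I_N}) r (M : X -> Y -> 'M[CC]_#|basis N|) (i : 'I_N) :
  i \notin S -> factored S r M -> factored (i |: S) (4 * r) M.
Proof.
move=> iS [J [A [B [hJ hA hB hM]]]].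
(* The two bits are exchanged in Alice's matrix unit because her factors enter the sum through their
   adjoints. *)
exists ((bool * bool) * J)%type,
  (fun x e => qunit i e.1.2 e.1.1 *m A x e.2), (fun y e => slice i e.1.1 e.1.2 (B y e.2)); split.
- by rewrite !card_prod card_bool hJ.
- move=> x [[b b'] j] /=; have [cA kA] := hA x j; split.
    apply: commutes_withM; last first.
      by apply: commutes_with_subset cA; rewrite setCS subsetUr.
    apply: (commutes_with_acts_on (acts_on_subset _ (acts_on_qunit i b' b))).
    by rewrite subsetUl.
  exact: contractionM (contraction_qunit _ _ _) kA.
- move=> y [[b b'] j] /=; have [cB kB] := hB y j.
  by split; [apply: commutes_with_slice | apply: contraction_slice].
- move=> x y; rewrite hM.
  rewrite -(pair_bigA _ (fun e j => adjmx (qunit i e.2 e.1 *m A x j) *m slice i e.1 e.2 (B y j))) /=.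
  rewrite exchange_big /=; apply: eq_bigr => j _.
  rewrite -(pair_bigA _ (fun b b' => adjmx (qunit i b' b *m A x j) *m slice i b b' (B y j))) /=.
  rewrite -{1}(sum_slice i (B y j)) mulmx_sumr; apply: eq_bigr => b _.
  rewrite mulmx_sumr; apply: eq_bigr => b' _.
  by rewrite adjmxM qunit_adj mulmxA.
Qed.

Lemma factored_move (X Y : Type) N (S T : {set 'I_N}) r (M : X -> Y -> 'M[CC]_#|basis N|) :
  [disjoint T & S] -> factored S r M -> factored (T :|: S) (4 ^ #|T| * r) M.
Proof.
elim: {T}#|T| {-2}T (erefl #|T|) => [|k IH] T cT dT hM.
  by move: cT => /cards0_eq->; rewrite set0U cards0 mul1n.
have /card_gt0P[i iT] : (0 < #|T|)%N by rewrite cT.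
have cT' : #|T :\ i| = k by move: cT; rewrite (cardsD1 i) iT => -[].
rewrite cT expnS -mulnA -(setD1K iT) -setUA -cT'; apply: factored_move1.
  by rewrite !inE eqxx /= (disjointFr dT).
apply: IH => //; apply: disjointWl dT; exact: subsetDl.
Qed.

Lemma factored_move_other (X Y : Type) N (S T : {set 'I_N}) r (M : X -> Y -> 'M[CC]_#|basis N|) :
  T \subset S -> factored S r M -> factored (S :\: T) (4 ^ #|T| * r) M.
Proof.
move=> TS /factored_sym /(factored_move (T := T)).
have dT : [disjoint T & ~: S] by rewrite disjoints_subset setCK.
move=> /(_ dT) /factored_sym; rewrite setCU setCK setIC -setDE.
by apply: eq_factored => x y; rewrite adjmxK.
Qed.

(** * Pulling the output observable back through a protocol *)

Lemma dot_cv N (v : vec N) : dot (cv_of_vec v) (cv_of_vec v) = \sum_x `|v x| ^+ 2.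
Proof.
rewrite dotE -sum_enum_val; apply: eq_bigr => i _.
by rewrite mxE mulrC -normCK.
Qed.

Lemma prob_oneE N (v : vec N) (o : 'I_N) :
  prob_one v o = dot (cv_of_vec v) (qunit o true true *m cv_of_vec v).
Proof.
have e : qunit o true true = adjmx (qunit o true true) *m qunit o true true.
  by rewrite qunit_adj qunitM eqxx.
rewrite e -mulmxA dot_adj adjmxK -cv_of_applyop dot_cv /prob_one big_mkcond /=.
have qE x y : qunit_op o true true x y = (x o && (y == x))%:R.
  rewrite qunit_opE eqb_id; case: (boolP (x o)) => // hx.
  by rewrite (_ : upd x o true = x) // -[RHS](upd_id x o) hx.
apply: eq_bigr => x _; rewrite /applyop (bigD1 x) //= qE eqxx andbT.
rewrite big1 ?addr0 => [|y /negPf hy]; last by rewrite qE hy andbF mul0r.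
by case: (x o); rewrite ?mul1r // mul0r normr0 expr0n.
Qed.

(** [M] is the output projector in the Heisenberg picture. It is chosen before the initial state
    [v], so the induction hypothesis applies to the state left by the first round. *)
Lemma run_factored n N (rs : seq (round n N)) (ownA : {set 'I_N}) (o : 'I_N) :
  rounds_valid ownA rs ->
  exists M : input n -> input n -> 'M[CC]_#|basis N|,
    factored ownA (4 ^ (\sum_(r <- rs) #|r_send r|)) M /\
    forall v x y, prob_one (run x y rs v) o = dot (cv_of_vec v) (M x y *m cv_of_vec v).
Proof.
elim: rs ownA => [|[al U T] rs IH] ownA /=.
  move=> _; exists (fun _ _ => qunit o true true); rewrite big_nil; split.
    exact: factored_qunit.
  by move=> v x y; rewrite prob_oneE.
rewrite /next_ownA /= => -[hU hT /IH [M [hM hv]]]; rewrite big_cons expnD /=.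
exists (fun x y => adjmx (mx_of_op (U (if al then x else y))) *m M x y *m mx_of_op (U (if al then x else y))).
split; last first.
  by move=> v x y; rewrite hv cv_of_applyop -!mulmxA [RHS]dot_adj adjmxK.
case: al hU hT hM {hv} => /= hU hT hM.
  apply: factored_op => //.
  have dT : [disjoint T & ownA :\: T] by rewrite disjoint_sym -setI_eq0 setIDAC setDIl setDv setI0.
  have := factored_move dT hM.
  by rewrite setDE setUIr setUCr setIT (setUidPr hT).
apply: factored_op_other => //.
have := factored_move_other (subsetUr ownA T) hM.
rewrite setDUl setDv setU0; have /setDidPl -> // : [disjoint ownA & T].
by rewrite disjoint_sym disjoints_subset.
Qed.

(** Alice's vector concatenates the vectors [A x j *m psi] over [j], Bob's likewise, with real and
    imaginary parts as separate coordinates. Each of the [4 ^ cost] blocks has norm at most 1, since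
    the factors are contractions. *)
Lemma ent_acc_factorization n (P : ent_protocol n) : ent_valid P ->
  exists (d : nat) (a b : input n -> 'I_d -> RR),
  [/\ forall x, \sum_i a x i ^+ 2 <= 4 ^+ ent_cost P,
      forall y, \sum_i b y i ^+ 2 <= 4 ^+ ent_cost P &
      forall x y, ent_acc P x y = toC (\sum_i a x i * b y i)].
Proof.
move=> [psi1 /(run_factored (e_out P)) [M [[J [A [B [hJ hA hB hM]]]] hacc]]].
set psi := cv_of_vec (e_psi0 P) in hacc.
have psi_1 : dot psi psi = 1 by rewrite dot_cv.
pose part (e : bool) (z : CC) : RR := if e then complex.Re z else complex.Im z.
have part_norm z : toC (\sum_e part e z ^+ 2) = z^* * z.
  rewrite big_bool /part /=; case: z => a b; apply/eqP; rewrite eq_complex /=.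
  by apply/andP; split; apply/eqP; ring.
have part_dot z w : \sum_e part e z * part e w = complex.Re (z^* * w).
  by rewrite big_bool /part; case: z w => [a b] [a' b'] /=; ring.
pose I : finType := (J * 'I_#|basis (e_N P)| * bool)%type.
pose coord (F : J -> 'M[CC]_#|basis (e_N P)|) (i : I) : RR := part i.2 ((F i.1.1 *m psi) i.1.2 ord0).
have sumI (F : I -> RR) : \sum_(i < #|I|) F (enum_val i) = \sum_j \sum_l \sum_e F (j, l, e).
  rewrite -(big_enum_val F) pair_bigA pair_bigA.
  by apply: eq_bigr => -[[j l] e] _.
have bound (F : J -> 'M[CC]_#|basis (e_N P)|) : (forall j, contraction (F j)) ->
    \sum_(i < #|I|) coord F (enum_val i) ^+ 2 <= 4 ^+ ent_cost P.
  move=> hF; rewrite (sumI (fun i => coord F i ^+ 2)) -toC_le -natrX rmorph_nat -hJ rmorph_sum.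
  have -> : #|J|%:R = \sum_(j : J) 1 :> CC by rewrite sumr_const.
  apply: ler_sum => j _; apply: le_trans (_ : dot (F j *m psi) (F j *m psi) <= _).
    by rewrite dotE rmorph_sum; apply: ler_sum => l _; rewrite -part_norm.
  by apply: le_trans (hF j _) _; rewrite psi_1.
exists #|I|, (fun x i => coord (A x) (enum_val i)), (fun y i => coord (B y) (enum_val i)); split.
- by move=> x; apply: bound => j; have [] := hA x j.
- by move=> y; apply: bound => j; have [] := hB y j.
(* The real inner product only yields the real part of the complex one; this suffices because the
   acceptance probability is real. *)
- move=> x y; have acc_ge0 : 0 <= ent_acc P x y by apply: sumr_ge0 => z _; rewrite exprn_ge0.
  rewrite -[LHS](RRe_real (ger0_real acc_ge0)); congr toC.
  rewrite (sumI (fun i => coord (A x) i * coord (B y) i)).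
  rewrite /ent_acc hacc hM mulmx_suml dot_sumr raddf_sum; apply: eq_bigr => j _.
  rewrite -mulmxA dot_adj adjmxK dotE raddf_sum; apply: eq_bigr => l _.
  exact: (esym (part_dot ((A x j *m psi) l ord0) ((B y j *m psi) l ord0))).
Qed.

(** * Dimension reduction *)

(** [X a] is the sum of the [a i] with independent uniform signs, one new sign per induction step.
    Expectations are written as sums over [Om]; the last clause is Khintchine's inequality for the
    fourth moment. *)
Lemma rademacher (R : realFieldType) (d : nat) :
  exists (Om : finType) (X : ('I_d -> R) -> Om -> R), [/\ (0 < #|Om|)%N,
    forall a b, \sum_w X a w * X b w = #|Om|%:R * \sum_i a i * b i &
    forall a, \sum_w X a w ^+ 4 <= #|Om|%:R * (3 * (\sum_i a i ^+ 2) ^+ 2)].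
Proof.
elim: d => [|d [Om [X [Om0 X2 X4]]]].
  exists unit, (fun _ _ => 0); split; first by rewrite card_unit.
  - by move=> a b; rewrite big_ord0 !mulr0 big1_eq.
  - by move=> a; rewrite big_ord0 expr0n /= !mulr0 big1 // => i _; rewrite expr0n.
pose sg (e : bool) : R := if e then 1 else -1.
pose tl (a : 'I_d.+1 -> R) := fun i => a (lift ord0 i).
have card2 : #|{: bool * Om}|%:R = 2 * #|Om|%:R :> R.
  by rewrite card_prod card_bool natrM.
exists (bool * Om)%type, (fun a w => X (tl a) w.2 + sg w.1 * a ord0); split.
- by rewrite card_prod card_bool muln_gt0.
- move=> a b; rewrite card2 big_ord_recl.
  rewrite -(pair_bigA _ (fun e w => (X (tl a) w + sg e * a ord0) * (X (tl b) w + sg e * b ord0))) /=.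
  rewrite big_bool /= -big_split /=.
  (* Adding the two values of the new sign cancels the terms of odd degree in it. *)
  under eq_bigr => w _ do (rewrite (_ : _ + _ =
    2 * (X (tl a) w * X (tl b) w) + 2 * (a ord0 * b ord0)); last by rewrite /sg; ring).
  rewrite big_split /= -mulr_sumr X2 sumr_const -mulr_natr /tl; ring.
- move=> a; rewrite card2 big_ord_recl.
  rewrite -(pair_bigA _ (fun e w => (X (tl a) w + sg e * a ord0) ^+ 4)) /=.
  rewrite big_bool /= -big_split /=.
  under eq_bigr => w _ do (rewrite (_ : _ + _ =
    2 * X (tl a) w ^+ 4 + 12 * a ord0 ^+ 2 * (X (tl a) w * X (tl a) w) + 2 * a ord0 ^+ 4);
    last by rewrite /sg; ring).
  rewrite !big_split /= -!mulr_sumr X2 sumr_const -mulr_natr.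
  under [\sum_i tl a i * _]eq_bigr do rewrite -expr2.
  rewrite -/(tl a); have := X4 (tl a).
  set q := \sum_w _; rewrite -[\sum_(i < d) a _ ^+ 2]/(\sum_i tl a i ^+ 2).
  set s := \sum_i _; set o := #|Om|%:R; set u := a ord0.
  have o0 : 0 <= o by rewrite ler0n.
  have : 0 <= o * u ^+ 4 by rewrite mulr_ge0 // -[4%N]/(2 * 2)%N exprM sqr_ge0.
  move=> h1 h2; rewrite -subr_ge0 (_ : _ - _ =
    2 * (o * (3 * s ^+ 2) - q) + 4 * (o * u ^+ 4)); last by ring.
  lra.
Qed.

(** * Simultaneous sampling for finitely many functions *)

(** Method of conditional expectations: as no [Y z] has positive mean, appending a uniformly random
    point does not increase the expected sum of products, so some point keeps it below [#|Z|]. *)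
Lemma greedy_sampling (R : realFieldType) (Om Z : finType) (Y : Z -> Om -> R) :
  (0 < #|Om|)%N -> (forall z w, -1 <= Y z w) -> (forall z, \sum_w Y z w <= 0) ->
  forall D, exists s : D.-tuple Om, \sum_z \prod_(w <- s) (1 + Y z w) <= #|Z|%:R.
Proof.
move=> Om0 Y1 Y0; elim=> [|D [s hs]].
  exists [tuple]; under eq_bigr do rewrite big_nil.
  by rewrite sumr_const.
pose F w := \sum_z (1 + Y z w) * \prod_(v <- s) (1 + Y z v).
case: (boolP [exists w, F w <= #|Z|%:R]) => [/existsP[w hw]|].
  exists [tuple of w :: s]; apply: le_trans hw.
  by apply: ler_sum => z _; rewrite big_cons.
rewrite negb_exists => /forallP hF; exfalso.
have : \sum_w F w <= #|Om|%:R * #|Z|%:R.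
  rewrite /F exchange_big /=; apply: le_trans (_ : \sum_z #|Om|%:R * \prod_(v <- s) (1 + Y z v) <= _).
    apply: ler_sum => z _; rewrite -mulr_suml ler_wpM2r //.
      by rewrite big_seq prodr_ge0 // => v _; have := Y1 z v; lra.
    by rewrite big_split /= sumr_const -[_ *+ _]/(_%:R) gerDl Y0.
  by rewrite -mulr_sumr ler_wpM2l.
have [w0 _] : exists w0 : Om, true by move/card_gt0P: Om0 => [w0 _]; exists w0.
rewrite real_leNgt ?num_real // => /negP; apply.
rewrite mulr_natl -sumr_const; apply: ltr_sum; last by move=> w _; have := hF w; rewrite -ltNge.
by apply/hasP; exists w0; rewrite ?mem_index_enum.
Qed.

(* [RR] hides its instances from keyed matching, so the lemmas on Stdlib's [exp] are restated. *)
Lemma exp_add (x y : RR) :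
  Rtrigo_def.exp (x + y) = (Rtrigo_def.exp x : RR) * Rtrigo_def.exp y.
Proof. exact: Exp_prop.exp_plus. Qed.

(** The bound [1 + u <= exp u] at [u = - t / (1 + t)] gives [exp (t / (1 + t)) <= 1 + t], and
    [t - 2 * t ^+ 2] is at most [t / (1 + t)] in this range. *)
Lemma expR_quadratic_le (t : RR) : - (1 / 2) <= t -> Rtrigo_def.exp (t - 2 * t ^+ 2) <= 1 + t.
Proof.
move=> ht; have t1 : 0 < 1 + t by lra.
have hy : 1 - t / (1 + t) <= Rtrigo_def.exp (- (t / (1 + t))) .
  by have /RleP := Rpower.exp_ineq1_le (- (t / (1 + t))); rewrite RplusE.
have le1 : t - 2 * t ^+ 2 <= t / (1 + t).
  rewrite ler_pdivlMr //; have : 0 <= t ^+ 2 * (1 + 2 * t) by rewrite mulr_ge0 ?sqr_ge0 //; lra.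
  by nra.
have exp_le (u v : RR) : u <= v -> Rtrigo_def.exp u <= Rtrigo_def.exp v.
  rewrite le_eqVlt => /orP[/eqP-> //|/RltP h].
  by apply/RleP/RIneq.Rlt_le/Rpower.exp_increasing.
apply: le_trans (exp_le _ _ le1) _.
have e0 : 0 < Rtrigo_def.exp (t / (1 + t)) by apply/RltP/Exp_prop.exp_pos.
have hm : Rtrigo_def.exp (t / (1 + t)) * Rtrigo_def.exp (- (t / (1 + t))) = 1.
  by rewrite -exp_add subrr Rtrigo_def.exp_0.
have hd : 1 - t / (1 + t) = (1 + t)^-1 by field; rewrite gt_eqF.
rewrite hd in hy.
have := ler_wpM2l (ltW e0) hy; rewrite hm ler_pdivrMr // mul1r; exact.
Qed.

(** A Chernoff bound with a union bound over [Z]. The products of [greedy_sampling] are nonnegative,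
    so each one is at most [2 ^ p]; comparison of exponents through [expR_quadratic_le] then bounds
    each sum. The parameter [lam] is left to be optimized. *)
Lemma sampling_mean (Om Z : finType) (V : Z -> Om -> RR) (M lam : RR) (p D : nat) :
  (0 < #|Om|)%N -> (forall z w, `|V z w| <= M) -> (forall z, \sum_w V z w <= 0) ->
  (#|Z| <= 2 ^ p)%N -> 0 < lam -> lam * M <= 1 / 2 ->
  exists s : D.-tuple Om, forall z,
    lam * \sum_(w <- s) V z w <= D%:R * (2 * (lam * M) ^+ 2) + p%:R.
Proof.
move=> Om0 VM V0 Zp lam0 lamM.
have bV z w : `|lam * V z w| <= lam * M.
  by rewrite normrM gtr0_norm // ler_wpM2l // ltW.
have bV2 z w : - (1 / 2) <= lam * V z w.
  have := le_trans (bV z w) lamM; rewrite ler_norml => /andP[]; lra.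
have [||s hs] := @greedy_sampling RR Om Z (fun z w => lam * V z w) Om0 _ _ D.
- by move=> z w /=; have := bV2 z w; lra.
- by move=> z; rewrite -mulr_sumr; apply: mulr_ge0_le0 => //; apply: ltW.
exists s => z.
set u := fun w => lam * V z w - 2 * (lam * V z w) ^+ 2.
have expS (r : seq Om) : Rtrigo_def.exp (\sum_(w <- r) u w) <= \prod_(w <- r) (1 + lam * V z w).
  elim: r => [|w r IH]; first by rewrite !big_nil Rtrigo_def.exp_0.
  rewrite !big_cons exp_add ler_pM //.
  - by apply/RleP/RIneq.Rlt_le/Exp_prop.exp_pos.
  - by apply/RleP/RIneq.Rlt_le/Exp_prop.exp_pos.
  - exact: expR_quadratic_le.
have prodZ : \prod_(w <- s) (1 + lam * V z w) <= 2 ^+ p.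
  apply: (@le_trans _ _ (#|Z|%:R)); last by rewrite -natrX ler_nat.
  apply: le_trans hs; rewrite (bigD1 z) //= lerDl sumr_ge0 // => z' _.
  by rewrite big_seq prodr_ge0 // => w _; have := bV2 z' w; lra.
have exp2 q : 2 ^+ q <= Rtrigo_def.exp (q%:R : RR).
  elim: q => [|q IH]; first by rewrite expr0 Rtrigo_def.exp_0.
  rewrite exprS -[q.+1]add1n natrD exp_add ler_pM ?exprn_ge0 //.
  by have /RleP := Rpower.exp_ineq1_le 1; rewrite RplusE.
have : \sum_(w <- s) u w <= p%:R.
  rewrite leNgt; apply/negP => /RltP/Rpower.exp_increasing/RltP.
  by rewrite ltNge (le_trans (expS s)) // (le_trans prodZ).
rewrite /u sumrB -!mulr_sumr => h.
have : \sum_(w <- s) (lam * V z w) ^+ 2 <= D%:R * (lam * M) ^+ 2.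
  apply: (@le_trans _ _ (\sum_(w <- s) (lam * M) ^+ 2)).
    by apply: ler_sum => w _; rewrite -real_normK ?num_real // ler_pXn2r ?nnegrE // (le_trans _ (bV z w)).
  by rewrite big_const_seq count_predT size_tuple iter_addr_0 mulr_natl.
lra.
Qed.

(** * Truncated random signs and dimension reduction *)

Definition trunc (R : realFieldType) (B t : R) := Num.max (- B) (Num.min B t).

(** Beyond the cutoff, the last inequality says that [(|t| - 2 * B) ^+ 2] is nonnegative. *)
Lemma trunc_spec (R : realFieldType) (B t : R) : 0 < B ->
  [/\ `|trunc B t| <= B, `|trunc B t| <= `|t| & 4 * B * `|t - trunc B t| <= t ^+ 2].
Proof.
move=> B0; rewrite /trunc.
have sq (u : R) : 0 <= (u - 2 * B) ^+ 2 by exact: sqr_ge0.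
case: (lerP B t) => h1; last case: (lerP t (- B)) => h2.
- have -> : Num.max (- B) B = B by apply/max_idPr; lra.
  rewrite !ger0_norm; try lra; split=> //; have := sq t; lra.
- rewrite !ler0_norm; try lra; split; try lra.
  by have := sq (- t); lra.
- rewrite subrr normr0 mulr0 sqr_ge0; split=> //.
  by rewrite ler_norml; apply/andP; split; lra.
Qed.

(** One factor is replaced at a time, and the mixed terms [|s| * t ^+ 2] are separated by the
    arithmetic-geometric mean inequality. Only second and fourth moments remain, which [rademacher]
    controls. *)
Lemma trunc_mul_error (R : realFieldType) (B s t : R) : 0 < B ->
  8 * B * `|s * t - trunc B s * trunc B t| <= s ^+ 2 + s ^+ 4 + t ^+ 2 + t ^+ 4.
Proof.
move=> B0; have [_ s2 s3] := trunc_spec s B0; have [t1 t2 t3] := trunc_spec t B0.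
set s' := trunc B s in s2 s3 *; set t' := trunc B t in t1 t2 t3 *.
have : `|s * t - s' * t'| <= `|s| * `|t - t'| + `|s - s'| * `|t|.
  rewrite (_ : s * t - s' * t' = s * (t - t') + (s - s') * t'); last by ring.
  by rewrite (le_trans (ler_normD _ _)) // !normrM lerD // ler_wpM2l.
move=> h.
have h1 : `|s| * (4 * B * `|t - t'|) <= `|s| * t ^+ 2 by rewrite ler_wpM2l.
have h2 : `|t| * (4 * B * `|s - s'|) <= `|t| * s ^+ 2 by rewrite ler_wpM2l.
have amgm (u v : R) : 2 * (`|u| * v ^+ 2) <= u ^+ 2 + v ^+ 4.
  rewrite -subr_ge0 -[u ^+ 2](real_normK (num_real _)).
  by rewrite (_ : _ - _ = (`|u| - v ^+ 2) ^+ 2) ?sqr_ge0 //; ring.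
have := amgm s t; have := amgm t s.
have : 8 * B * `|s * t - s' * t'| <= 8 * B * (`|s| * `|t - t'| + `|s - s'| * `|t|).
  by rewrite ler_wpM2l //; lra.
lra.
Qed.

(** The inner product is the mean of a product of random sign sums. Truncation changes this mean by
    at most [eta / 2]; replacing it by the average over [D] points, chosen for all pairs at once,
    costs another [eta / 2]. *)
Lemma dimension_reduction (F : finType) (d : nat) (a : F -> 'I_d -> RR) (eta : RR) (p D : nat) :
  0 < eta <= 1 -> (forall z, \sum_i a z i ^+ 2 <= 1) ->
  (2 * #|F| ^ 2 <= 2 ^ p)%N -> (0 < D)%N -> 2048 * p%:R <= D%:R * eta ^+ 6 ->
  exists a' : F -> 'I_D -> RR, forall z z',
    `|\sum_j a' z j * a' z' j - \sum_i a z i * a z' i| <= eta.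
Proof.
move=> /andP[eta0 eta1] a1 Fp D0 hD.
have [Om [X [Om0 X2 X4]]] := rademacher RR d.
set o : RR := #|Om|%:R; have o0 : 0 < o by rewrite ltr0n.
(* The moments in [trunc_mul_error] add up to at most [8 * o], so the bias is at most [1 / B]. *)
pose B := 2 / eta; have B0 : 0 < B by rewrite divr_gt0.
pose t z w := trunc B (X (a z) w).
pose m z z' := o^-1 * \sum_w t z w * t z' w.
have X2' z : \sum_w X (a z) w ^+ 2 <= o.
  under eq_bigr do rewrite expr2.
  rewrite X2 -[leRHS]mulr1 ler_wpM2l //.
  by under eq_bigr do rewrite -expr2.
have X4' z : \sum_w X (a z) w ^+ 4 <= 3 * o.
  apply: le_trans (X4 _) _; rewrite mulrC ler_pM2r // -[leRHS]mulr1 ler_wpM2l //.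
  by rewrite exprn_ile1 // sumr_ge0 // => i _; rewrite sqr_ge0.
have bias z z' : `|m z z' - \sum_i a z i * a z' i| <= eta / 2.
  have -> : m z z' - \sum_i a z i * a z' i =
      - (o^-1 * \sum_w (X (a z) w * X (a z') w - t z w * t z' w)).
    by rewrite sumrB X2 /m -/o; field; rewrite gt_eqF.
  rewrite normrN normrM gtr0_norm ?invr_gt0 // ler_pdivrMl //.
  apply: le_trans (ler_norm_sum _ _ _) _.
  have : 8 * B * \sum_w `|X (a z) w * X (a z') w - t z w * t z' w| <= 8 * o.
    rewrite mulr_sumr.
    apply: (@le_trans _ _ (\sum_w (X (a z) w ^+ 2 + X (a z) w ^+ 4 + X (a z') w ^+ 2 + X (a z') w ^+ 4))).
      by apply: ler_sum => w _; apply: trunc_mul_error.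
    rewrite !big_split /=; have := X2' z; have := X2' z'; have := X4' z; have := X4' z'; lra.
  set S := \sum_w _; move=> h.
  have e1 : eta * (8 * B * S) <= eta * (8 * o) by rewrite ler_wpM2l // ltW.
  have e2 : eta * (8 * B * S) = 16 * S by rewrite /B; field; rewrite gt_eqF.
  lra.
pose sg (e : bool) : RR := if e then 1 else -1.
(* Both signs of each deviation are included, so one-sided sampling bounds give a two-sided
   estimate; this is the factor 2 in the bound on [2 ^ p]. *)
pose V (q : bool * (F * F)) w := sg q.1 * (t q.2.1 w * t q.2.2 w - m q.2.1 q.2.2).
have tB z z' w : `|t z w * t z' w| <= B ^+ 2.
  rewrite normrM expr2; have [h1 _ _] := trunc_spec (X (a z) w) B0.
  by have [h2 _ _] := trunc_spec (X (a z') w) B0; rewrite ler_pM.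
have VM q w : `|V q w| <= 2 * B ^+ 2.
  have -> : `|V q w| = `|t q.2.1 w * t q.2.2 w - m q.2.1 q.2.2|.
    by rewrite /V /sg; case: q.1; rewrite ?mul1r // mulN1r normrN.
  apply: le_trans (ler_normB _ _) _; rewrite [2]mulrSr mulrDl mul1r lerD //.
  rewrite /m normrM gtr0_norm ?invr_gt0 // ler_pdivrMl //.
  apply: le_trans (ler_norm_sum _ _ _) _.
  by apply: le_trans (ler_sum _ (fun w _ => tB _ _ w)) _; rewrite sumr_const mulr_natl.
have V0 q : \sum_w V q w <= 0.
  rewrite /V -mulr_sumr sumrB sumr_const -[_ *+ _]mulr_natl -/o /m mulrA mulfV ?gt_eqF //.
  by rewrite mul1r subrr mulr0.
(* With [|V| <= 2 * B ^+ 2] this choice makes the quadratic term [D * eta ^+ 6 / 2048]. The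
   hypothesis on [D] bounds [p] by the same amount, and the two add up to [lam * D * eta / 2]. *)
pose lam := eta ^+ 5 / 512.
have lam0 : 0 < lam by rewrite divr_gt0 ?exprn_gt0.
have lamB : lam * (2 * B ^+ 2) = eta ^+ 3 / 64.
  by rewrite /lam /B; field; rewrite gt_eqF.
have hZ : (#|{: bool * (F * F)}| <= 2 ^ p)%N by rewrite !card_prod card_bool mulnn.
have lamM : lam * (2 * B ^+ 2) <= 1 / 2.
  have : eta ^+ 3 <= 1 by rewrite exprn_ile1 // ltW.
  by rewrite lamB; lra.
have [s hs] := sampling_mean D Om0 VM V0 hZ lam0 lamM.
have D0' : 0 < D%:R :> RR by rewrite ltr0n.
have samp q : \sum_(w <- s) V q w <= D%:R * (eta / 2).
  rewrite -(ler_pM2l lam0); apply: le_trans (hs q) _; rewrite lamB.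
  have -> : lam * (D%:R * (eta / 2)) = D%:R * eta ^+ 6 / 1024 by rewrite /lam; field.
  have -> : D%:R * (2 * (eta ^+ 3 / 64) ^+ 2) = D%:R * eta ^+ 6 / 2048 by field.
  lra.
exists (fun z j => t z (tnth s j) / Num.sqrt D%:R) => z z'.
have -> : \sum_j t z (tnth s j) / Num.sqrt D%:R * (t z' (tnth s j) / Num.sqrt D%:R) =
    D%:R^-1 * \sum_(w <- s) t z w * t z' w.
  rewrite big_tuple mulr_sumr; apply: eq_bigr => j _.
  by rewrite mulrACA -expr2 exprVn sqr_sqrtr ?ler0n // mulrC.
have h1 := samp (true, (z, z')); have h2 := samp (false, (z, z')).
rewrite /V /= in h1 h2.
have est : `|\sum_(w <- s) t z w * t z' w - D%:R * m z z'| <= D%:R * (eta / 2).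
  move: h1 h2; rewrite -!mulr_sumr mul1r mulN1r sumrB big_const_seq count_predT size_tuple.
  rewrite iter_addr_0 -[m z z' *+ D]mulr_natl => h1 h2.
  by rewrite ler_norml h1 lerNl h2.
have -> : D%:R^-1 * (\sum_(w <- s) t z w * t z' w) - \sum_i a z i * a z' i =
   D%:R^-1 * (\sum_(w <- s) t z w * t z' w - D%:R * m z z') + (m z z' - \sum_i a z i * a z' i).
  by field; rewrite gt_eqF.
apply: le_trans (ler_normD _ _) _.
have : `|D%:R^-1 * (\sum_(w <- s) t z w * t z' w - D%:R * m z z')| <= eta / 2.
  by rewrite normrM gtr0_norm ?invr_gt0 // ler_pdivrMl.
by have := bias z z'; lra.
Qed.

(** * Repeated swap tests *)

Lemma eq_card_bijection (S T : finType) : #|S| = #|T| ->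
  exists (c : S -> T) (d : T -> S), cancel c d /\ cancel d c.
Proof.
move=> e; exists (fun x => enum_val (cast_ord e (enum_rank x))),
  (fun y => enum_val (cast_ord (esym e) (enum_rank y))).
by split=> x; rewrite enum_valK ?cast_ordK ?cast_ordKV enum_rankK.
Qed.

(** Packs real product states and a measurement in the basis given by the rows of [T] into qubits:
    the messages are bit encodings of [MA] and [MB], and one ancilla records whether the outcome
    satisfies [g]. The ensembles are trivial, since the messages are pure. *)
Lemma smp_of_measurement n (MA MB : finType) (a b : nat)
    (Phi : input n -> MA -> RR) (Psi : input n -> MB -> RR)
    (T : MA * MB -> MA * MB -> RR) (g : pred (MA * MB)) :
  #|MA| = (2 ^ a)%N -> #|MB| = (2 ^ b)%N ->
  (forall x, \sum_p Phi x p ^+ 2 = 1) -> (forall y, \sum_q Psi y q ^+ 2 = 1) ->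
  (forall z z', \sum_w T w z * T w z' = (z == z')%:R) ->
  exists S : smp_protocol n, [/\ smp_valid S, smp_cost S = (a + b)%N &
    forall x y, smp_acc S x y =
      toC (\sum_(z | g z) (\sum_w T z w * (Phi x w.1 * Psi y w.2)) ^+ 2)].
Proof.
move=> cardA cardB Phi1 Psi1 T1.
have cb c : #|{ffun 'I_c -> bool}| = (2 ^ c)%N by rewrite card_ffun card_bool card_ord.
have [cA [dA [cAK dAK]]] : exists (c : MA -> {ffun 'I_a -> bool}) d, cancel c d /\ cancel d c.
  by apply: eq_card_bijection; rewrite cardA cb.
have [cB [dB [cBK dBK]]] : exists (c : MB -> {ffun 'I_b -> bool}) d, cancel c d /\ cancel d c.
  by apply: eq_card_bijection; rewrite cardB cb.
(* The qubits are Alice's [a], Bob's [b], and [None] for the ancilla that becomes the output. *)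
pose Q : finType := option ('I_a + 'I_b).
pose iA (j : 'I_a) : 'I_#|Q| := enum_rank (Some (inl j) : Q).
pose iB (j : 'I_b) : 'I_#|Q| := enum_rank (Some (inr j) : Q).
pose io : 'I_#|Q| := enum_rank (None : Q).
pose bas (w : MA * MB * bool) : basis #|Q| := [ffun i =>
  match (enum_val i : Q) with
  | None => w.2 | Some (inl j) => cA w.1.1 j | Some (inr j) => cB w.1.2 j end].
pose ubas (z : basis #|Q|) : MA * MB * bool :=
  (dA [ffun j => z (iA j)], dB [ffun j => z (iB j)], z io).
have basA w j : bas w (iA j) = cA w.1.1 j by rewrite ffunE enum_rankK.
have basB w j : bas w (iB j) = cB w.1.2 j by rewrite ffunE enum_rankK.
have baso w : bas w io = w.2 by rewrite ffunE enum_rankK.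
have basK : cancel bas ubas.
  move=> [[p q] o]; rewrite /ubas baso /=; congr (_, _, _).
    by rewrite -[RHS]cAK; congr dA; apply/ffunP => j; rewrite ffunE basA.
  by rewrite -[RHS]cBK; congr dB; apply/ffunP => j; rewrite ffunE basB.
have idx (P : 'I_#|Q| -> Prop) : (forall j, P (iA j)) -> (forall j, P (iB j)) -> P io ->
    forall i, P i.
  by move=> hA hB ho i; rewrite -(enum_valK i); case: (enum_val i) => [[]|].
have ubasK : cancel ubas bas.
  move=> z; apply/ffunP; elim/idx => [j|j|].
  - by rewrite basA /= dAK !ffunE.
  - by rewrite basB /= dBK !ffunE.
  - by rewrite baso.
have sum_bas (P : pred (basis #|Q|)) (F : basis #|Q| -> CC) : \sum_(z | P z) F z = \sum_(w | P (bas w)) F (bas w).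
  by rewrite (reindex bas) //; exists ubas => ? _.
pose SA := [set iA j | j : 'I_a]; pose SB := [set iB j | j : 'I_b].
have iA_inj : injective iA by move=> j k /enum_rank_inj [].
have iB_inj : injective iB by move=> j k /enum_rank_inj [].
have inA : (forall j, iA j \in SA) * (forall j, iA j \in SB = false).
  split=> j; first by rewrite imset_f.
  by apply/negbTE/imsetP => -[k _ /enum_rank_inj].
have inB : (forall j, iB j \in SA = false) * (forall j, iB j \in SB).
  split=> j; last by rewrite imset_f.
  by apply/negbTE/imsetP => -[k _ /enum_rank_inj].
have ino : (io \in SA = false) * (io \in SB = false).
  by split; apply/negbTE/imsetP => -[k _ /enum_rank_inj].
(* These elements are encoded by all-zero strings; [proj] resets the qubits outside its set to
   them. *)
pose p0 := dA [ffun => false]; pose q0 := dB [ffun => false].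
have projA w : proj SA (bas w) = bas (w.1.1, q0, false).
  apply/ffunP; elim/idx => [j|j|]; rewrite ffunE.
  - by rewrite ?inA /= !basA.
  - by rewrite inB /= basB /= dBK !ffunE.
  - by rewrite ino /= baso.
have projB w : proj SB (bas w) = bas (p0, w.1.2, false).
  apply/ffunP; elim/idx => [j|j|]; rewrite ffunE.
  - by rewrite inA /= basA /= dAK !ffunE.
  - by rewrite inB ?orbT /= !basB.
  - by rewrite ino /= baso.
have projAB w : proj (SA :|: SB) (bas w) = bas (w.1, false).
  apply/ffunP; elim/idx => [j|j|]; rewrite ffunE inE.
  - by rewrite !inA /= !basA.
  - by rewrite !inB ?orbT /= !basB.
  - by rewrite !ino /= baso.
have basE w w' : (bas w == bas w') = (w == w') by rewrite (can_eq basK).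
pose psiA (x : input n) (_ : 'I_1) : vec #|Q| := fun z =>
  toC (Phi x (ubas z).1.1) * (z == proj SA z)%:R.
pose psiB (y : input n) (_ : 'I_1) : vec #|Q| := fun z =>
  toC (Psi y (ubas z).1.2) * (z == proj SB z)%:R.
(* [T] is applied to the messages, then [g] of the result is added modulo 2 to the ancilla. *)
pose U : op #|Q| := fun z z' =>
  toC (T (ubas z).1 (ubas z').1) * ((ubas z).2 == (ubas z').2 (+) g (ubas z).1)%:R.
exists {| s_N := #|Q|; s_A := SA; s_B := SB; s_KA := 1; s_pA := fun _ _ => 1; s_psiA := psiA;
  s_KB := 1; s_pB := fun _ _ => 1; s_psiB := psiB; s_U := U; s_out := io |}; split.
- split=> /=.
  + rewrite -setI_eq0; apply/eqP/setP; elim/idx => [j|j|]; rewrite !inE.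
    * by rewrite !inA.
    * by rewrite !inB.
    * by rewrite !ino.
  + move=> z z'; rewrite sum_bas -[z]ubasK -[z']ubasK; move: (ubas z) (ubas z') => [w o] [w' o'].
    rewrite basE xpair_eqE -(pair_bigA _ (fun v e => (U (bas (v, e)) (bas (w, o)))^* * U (bas (v, e)) (bas (w', o')))) /=.
    transitivity (\sum_v toC (T v w * T v w') * (o == o')%:R).
      apply: eq_bigr => v _; rewrite big_bool /U !basK /=.
      rewrite !rmorphM /= !toC_conj !rmorph_nat.
      by case: o; case: o'; case: (g v); rewrite /= !(mulr0, mul0r, mulr1, addr0, add0r).
    by rewrite -mulr_suml -rmorph_sum T1 rmorph_nat -natrM mulnb.
  + split=> [x|x e|y|y e]; rewrite ?big_ord1 //.
    * split; last by move=> z; rewrite /psiA => /negPf->; rewrite mulr0.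
      rewrite /unit_vec sum_bas -(rmorph1 toC) -(Phi1 x) rmorph_sum.
      rewrite (bigID (fun w => w == (w.1.1, q0, false))) /= [X in _ + X]big1 ?addr0; last first.
        by move=> w /negPf hw; rewrite /psiA projA basE hw mulr0 normr0 expr0n.
      rewrite (reindex (fun p => (p, q0, false))) /=; last first.
        by exists (fun w => w.1.1) => // w; rewrite inE => /eqP.
      apply: eq_big => [p|p _]; first by rewrite eqxx.
      by rewrite /psiA projA eqxx basK mulr1 toC_normsq.
    * split; last by move=> z; rewrite /psiB => /negPf->; rewrite mulr0.
      rewrite /unit_vec sum_bas -(rmorph1 toC) -(Psi1 y) rmorph_sum.
      rewrite (bigID (fun w => w == (p0, w.1.2, false))) /= [X in _ + X]big1 ?addr0; last first.
        by move=> w /negPf hw; rewrite /psiB projB basE hw mulr0 normr0 expr0n.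
      rewrite (reindex (fun p => (p0, p, false))) /=; last first.
        by exists (fun w => w.1.2) => // w; rewrite inE => /eqP.
      apply: eq_big => [p|p _]; first by rewrite eqxx.
      by rewrite /psiB projB eqxx basK mulr1 toC_normsq.
- by rewrite /smp_cost /= !card_imset // !card_ord.
- move=> x y; rewrite /smp_acc /= !big_ord1 !mul1r /prob_one sum_bas rmorph_sum.
  rewrite (eq_bigl (fun w => w.2)); last by move=> w; rewrite baso.
  rewrite -(pair_big_dep predT (fun w e => e) (fun w e => `|applyop U (tensor SA SB (psiA x ord0) (psiB y ord0)) (bas (w, e))| ^+ 2)) /=.
  rewrite [RHS]big_mkcond; apply: eq_bigr => w _.
  rewrite big_mkcond big_bool /= addr0.
  have -> : applyop U (tensor SA SB (psiA x ord0) (psiB y ord0)) (bas (w, true)) =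
      toC (\sum_v T w v * (Phi x v.1 * Psi y v.2)) * (g w)%:R.
    rewrite /applyop sum_bas -(pair_bigA _ (fun v e => U (bas (w, true)) (bas (v, e)) *
       tensor SA SB (psiA x ord0) (psiB y ord0) (bas (v, e)))) /=.
    rewrite rmorph_sum mulr_suml; apply: eq_bigr => v _.
    rewrite big_bool /= /tensor /psiA /psiB !projAB !projA !projB !basE !basK /= !eqxx.
    rewrite !(mulr0, add0r, mulr1) /U !basK /= !rmorphM /=.
    rewrite [in (v, true) == _]xpair_eqE andbF mulr0 mulr0 add0r.
    by case: (g w); rewrite ?mulr1 ?mulr0 ?mul0r.
  case: (g w); first by rewrite mulr1 toC_normsq.
  by rewrite mulr0 normr0 expr0n rmorph0.
Qed.

(** * Statistics of independent measurement outcomes *)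

Lemma isometry_sumsq (R : comNzRingType) (I : finType) (t : I -> I -> R) (v : I -> R) :
  (forall w w', \sum_z t z w * t z w' = (w == w')%:R) ->
  \sum_z (\sum_w t z w * v w) ^+ 2 = \sum_w v w ^+ 2.
Proof.
move=> ht.
under eq_bigr do rewrite expr2 mulr_suml.
rewrite exchange_big /=; apply: eq_bigr => w _.
under eq_bigr do rewrite mulr_sumr.
rewrite exchange_big /= (bigD1 w) //= [X in _ + X]big1 ?addr0 => [|w' /negPf ww'].
  under eq_bigr do rewrite mulrACA.
  by rewrite -mulr_suml ht eqxx mul1r expr2.
under eq_bigr do rewrite mulrACA.
by rewrite -mulr_suml ht eq_sym ww' mul0r.
Qed.

(** Expanding the square of the centred count, the terms with two different indices factor through
    the mean zero of [F], and each of the [k] diagonal terms is at most 1. *)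
Lemma count_variance (R : realFieldType) (Z : finType) (r : Z -> R) (h : pred Z) (k : nat) (mu : R) :
  (forall z, 0 <= r z) -> \sum_z r z = 1 -> \sum_(z | h z) r z = mu ->
  \sum_(p : {ffun 'I_k -> Z}) (\prod_i r (p i)) * (\sum_i (h (p i))%:R - k%:R * mu) ^+ 2 <= k%:R.
Proof.
move=> r0 r1 hmu.
pose F z : R := (h z)%:R - mu.
have rF : \sum_z r z * F z = 0.
  under eq_bigr do rewrite mulrBr mulr_natr.
  rewrite sumrB -mulr_suml r1 mul1r -hmu [X in _ - X]big_mkcond /= -sumrB big1 // => z _.
  by case: (h z); rewrite ?mulr1n ?mulr0n subrr.
have [mu0 mu1] : 0 <= mu /\ mu <= 1.
  rewrite -hmu -r1; split; first exact: sumr_ge0.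
  by rewrite [leRHS](bigID h) /= lerDl sumr_ge0.
have rF2 : \sum_z r z * F z ^+ 2 <= 1.
  rewrite -r1; apply: ler_sum => z _; rewrite -[leRHS]mulr1 ler_wpM2l // /F.
  rewrite -real_normK ?num_real // exprn_ile1 // ler_norml.
  by apply/andP; case: (h z) => /=; split; lra.
apply: (@le_trans _ _ (\sum_(i < k) \sum_(j < k) \sum_(p : {ffun 'I_k -> Z}) (\prod_l r (p l)) * (F (p i) * F (p j)))).
  rewrite [leRHS](_ : _ = \sum_(p : {ffun 'I_k -> Z}) \sum_i \sum_j (\prod_l r (p l)) * (F (p i) * F (p j))).
    apply: ler_sum => p _; rewrite le_eqVlt; apply/orP; left; apply/eqP.
    under [RHS]eq_bigr do rewrite -mulr_sumr; rewrite -mulr_sumr; congr (_ * _).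
    under [RHS]eq_bigr do rewrite -mulr_sumr.
    by rewrite -mulr_suml -expr2 sumrB sumr_const card_ord mulr_natl.
  rewrite [RHS]exchange_big /=; apply: eq_bigr => i _.
  by rewrite [RHS]exchange_big.
rewrite -[leRHS]mulr1 mulr_natl -[k in leRHS]card_ord -sumr_const; apply: ler_sum => i _.
have E j : \sum_(p : {ffun 'I_k -> Z}) (\prod_l r (p l)) * (F (p i) * F (p j)) =
    \prod_l \sum_z r z * ((if l == i then F z else 1) * (if l == j then F z else 1)).
  have pick m (p : {ffun 'I_k -> Z}) : \prod_l (if l == m then F (p l) else 1) = F (p m).
    by rewrite (bigD1 m) //= eqxx big1 ?mulr1 // => l /negPf->.
  by rewrite bigA_distr_bigA; apply: eq_bigr => p _; rewrite !big_split /= !pick.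
rewrite (bigD1 i) //= [X in _ + X]big1 ?addr0 => [|j /negPf ji].
  rewrite E (bigD1 i) //= eqxx [X in _ * X]big1 ?mulr1 => [|l /negPf->].
    by under eq_bigr do rewrite -expr2.
  by under eq_bigr do rewrite !mulr1.
rewrite E (bigD1 i) //= eqxx [i == j]eq_sym ji.
by under eq_bigr do rewrite mulr1; rewrite rF mul0r.
Qed.

(** Chebyshev's inequality: a deviation of [k * d] in the count has probability at most
    [k / (k * d) ^+ 2], which is at most [1 / 3]. *)
Lemma count_concentration (R : realFieldType) (Z : finType) (r : Z -> R) (h : pred Z)
    (k : nat) (mu tau d : R) :
  (forall z, 0 <= r z) -> \sum_z r z = 1 -> \sum_(z | h z) r z = mu ->
  0 < d -> 3 <= k%:R * d ^+ 2 ->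
  let P := \sum_(p : {ffun 'I_k -> Z} | \sum_i (h (p i))%:R <= k%:R * tau) \prod_i r (p i) in
  (mu + d <= tau -> 2 / 3 <= P) /\ (tau + d <= mu -> P <= 1 / 3).
Proof.
move=> r0 r1 hmu d0 kd.
have k0 : 0 < k%:R :> R.
  rewrite ltr0n lt0n; apply: contraTneq kd => ->; rewrite mul0r -ltNge; lra.
have := count_variance k r0 r1 hmu.
set c := fun p : {ffun 'I_k -> Z} => \sum_i (h (p i))%:R : R.
set w := fun p : {ffun 'I_k -> Z} => \prod_i r (p i) : R.
rewrite -[X in X <= _ -> _]/(\sum_p w p * (c p - k%:R * mu) ^+ 2) => var.
have w0 p : 0 <= w p by apply: prodr_ge0.
have w1 : \sum_p w p = 1.
  by rewrite -(bigA_distr_bigA (fun _ z => r z)) big1.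
have tail (A : pred {ffun 'I_k -> Z}) :
    (forall p, A p -> k%:R * d <= `|c p - k%:R * mu|) -> \sum_(p | A p) w p <= 1 / 3.
  move=> hA; have : (k%:R * d) ^+ 2 * \sum_(p | A p) w p <= k%:R.
    apply: le_trans var; rewrite [leRHS](bigID A) /= mulr_sumr -[leLHS]addr0 lerD //.
      apply: ler_sum => p /hA h'; rewrite mulrC ler_wpM2l //.
      rewrite -[leRHS]real_normK ?num_real // ler_pXn2r ?nnegrE //.
      by rewrite mulr_ge0 // ltW.
    by apply: sumr_ge0 => p _; rewrite mulr_ge0 // sqr_ge0.
  set S := \sum_(p | A p) _; have S0 : 0 <= S by apply: sumr_ge0.
  rewrite exprMn expr2 -!mulrA -[leRHS]mulr1 ler_pM2l // !mulrA.
  have : 3 * S <= k%:R * d ^+ 2 * S by rewrite ler_wpM2r.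
  lra.
move=> P; split=> hm; last first.
  apply: tail => p hp; rewrite distrC.
  apply: le_trans (ler_norm _); rewrite lerBrDl; apply: le_trans (lerD hp (lexx _)) _.
  by rewrite -mulrDr ler_pM2l.
have : \sum_(p | ~~ (c p <= k%:R * tau)) w p <= 1 / 3.
  apply: tail => p; rewrite -ltNge => hp; apply: le_trans (ler_norm _).
  rewrite lerBrDl; apply: le_trans (ltW hp).
  by rewrite -mulrDr ler_pM2l.
have : P + \sum_(p | ~~ (c p <= k%:R * tau)) w p = 1.
  by rewrite -[RHS]w1 [RHS](bigID (fun p => c p <= k%:R * tau)).
lra.
Qed.

(* The rows of [t] are eigenvectors of the swap operator; [h] selects the antisymmetric ones. *)
Lemma swap_diagonalization (R : rcfType) (W : finType) :
  exists (t : W * W -> W * W -> R) (h : pred (W * W)),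
    (forall w w', \sum_z t z w * t z w' = (w == w')%:R) /\
    forall al be : W -> R, \sum_a al a ^+ 2 = 1 -> \sum_a be a ^+ 2 = 1 ->
      \sum_(z | h z) (\sum_w t z w * (al w.1 * be w.2)) ^+ 2 =
      (1 - (\sum_a al a * be a) ^+ 2) / 2.
Proof.
pose c : R := (Num.sqrt 2)^-1.
have c2 : c ^+ 2 = 2^-1 by rewrite /c exprVn sqr_sqrtr.
pose sw (z : W * W) := (z.2, z.1).
have swK : involutive sw by case.
pose lt (z : W * W) := (enum_rank z.1 < enum_rank z.2)%N.
(* The enumeration order orients each pair of distinct elements: the increasing ordered pair indexes
   the symmetric vector, the decreasing one the antisymmetric vector. *)
pose sg (z : W * W) : R := if lt z then 1 else -1.
pose A (z : W * W) : R := if z.1 == z.2 then 1 else c.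
pose B (z : W * W) : R := if z.1 == z.2 then 0 else c * sg z.
have lt_sw z : z.1 != z.2 -> lt (sw z) = ~~ lt z.
  case: z => a b ab; rewrite /lt /= -leqNgt [RHS]leq_eqVlt orb_idl // => /eqP e.
  by rewrite (enum_rank_inj (val_inj e)) eqxx in ab.
pose t (z w : W * W) : R := A z * (w == z)%:R + B z * (w == sw z)%:R.
have tE z v : \sum_w t z w * v w = A z * v z + B z * v (sw z).
  under eq_bigr do rewrite mulrDl -!mulrA.
  rewrite big_split /= -!mulr_sumr; congr (_ * _ + _ * _).
    by rewrite (bigD1 z) //= eqxx mul1r big1 ?addr0 // => w /negPf->; rewrite mul0r.
  by rewrite (bigD1 (sw z)) //= eqxx mul1r big1 ?addr0 // => w /negPf->; rewrite mul0r.
(* [lt (sw z)] fails on the diagonal, where [~~ lt z] would hold; the diagonal rows are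
   symmetric. *)
exists t, (fun z => lt (sw z)); split.
  move=> w w'; transitivity (A w * t w w' + B (sw w) * t (sw w) w').
    rewrite [LHS](_ : _ = \sum_z (w == z)%:R * (A z * t z w') + \sum_z (w == sw z)%:R * (B z * t z w')).
      congr (_ + _).
        by rewrite (bigD1 w) //= eqxx mul1r big1 ?addr0 // => z /negPf; rewrite eq_sym => ->; rewrite mul0r.
      rewrite (bigD1 (sw w)) //= swK eqxx mul1r big1 ?addr0 // => z zw.
      by rewrite (negbTE (_ : w != sw z)) ?mul0r // -(inj_eq (can_inj swK)) swK eq_sym.
    by rewrite -big_split /=; apply: eq_bigr => z _; rewrite /t; ring.
  rewrite /t swK ![w' == _]eq_sym.
  have e : A w * B w + B (sw w) * A (sw w) = 0.
    rewrite /A /B /= [w.2 == w.1]eq_sym; case: eqVneq => hw; first by ring.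
    by rewrite /sg lt_sw //; case: (lt w) => /=; ring.
  have e' : A w * A w + B (sw w) * B (sw w) = 1.
    rewrite /A /B /= [w.2 == w.1]eq_sym; case: eqVneq => hw; first by ring.
    transitivity (c ^+ 2 * (1 + sg (sw w) ^+ 2)); first by ring.
    by rewrite c2 /sg; case: (lt _); field.
  transitivity ((A w * A w + B (sw w) * B (sw w)) * (w == w')%:R + (A w * B w + B (sw w) * A (sw w)) * (sw w == w')%:R).
    by ring.
  by rewrite e e' mul1r mul0r addr0.
move=> al be al1 be1.
under eq_bigr do rewrite tE.
pose F z : R := (al z.1 * be z.2 - al z.2 * be z.1) ^+ 2.
have FE z : lt (sw z) -> (A z * (al z.1 * be z.2) + B z * (al (sw z).1 * be (sw z).2)) ^+ 2 = F z / 2.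
  move=> hz; have z12 : z.1 != z.2 by apply: contraTneq hz; rewrite /lt /= => ->; rewrite ltnn.
  have /negPf lz : ~~ lt z by rewrite -lt_sw.
  rewrite /A /B (negbTE z12) /sg lz -c2 /F /=; ring.
rewrite (eq_bigr _ FE) -mulr_suml; congr (_ / 2).
(* Lagrange's identity for unit vectors. *)
have tot : \sum_z F z = 2 * (1 - (\sum_a al a * be a) ^+ 2).
  rewrite -(pair_bigA _ (fun a b => F (a, b))) /=.
  transitivity (\sum_a \sum_b (al a ^+ 2 * be b ^+ 2 + be a ^+ 2 * al b ^+ 2 - 2 * (al a * be a) * (al b * be b))).
    by apply: eq_bigr => a _; apply: eq_bigr => b _; rewrite /F /=; ring.
  transitivity (\sum_a (al a ^+ 2 + be a ^+ 2 - 2 * (al a * be a) * \sum_b al b * be b)).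
    by apply: eq_bigr => a _; rewrite sumrB big_split /= -!mulr_sumr al1 be1 !mulr1.
  by rewrite sumrB big_split /= al1 be1 -!mulr_suml -mulr_sumr; ring.
have half : \sum_z F z = 2 * \sum_(z | lt (sw z)) F z.
  rewrite (bigID (fun z => lt (sw z))) /= mulr_natl mulr2n; congr (_ + _).
  rewrite (bigID (fun z => z.1 == z.2)) /= big1 ?add0r => [|z /andP[_ /eqP e]]; last first.
    by rewrite /F e subrr expr0n.
  rewrite (reindex_inj (can_inj swK)) /=; apply: eq_big => [z|z _].
    rewrite swK; case: eqVneq => [e|ne]; last by rewrite andbT lt_sw // eq_sym.
    by rewrite andbF /lt /= e ltnn.
  by rewrite /F /=; ring.
by apply: (@mulfI _ 2); rewrite ?pnatr_eq0 // -half tot.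
Qed.

(** Each party sends [k] copies of its fingerprint. The referee performs [k] independent swap tests
    and accepts when at most [k * tau] outcomes are antisymmetric. *)
Lemma smp_of_fingerprints n (f : input n -> input n -> bool) (W : finType) (m k : nat)
    (alpha beta : input n -> W -> RR) (tau d : RR) :
  #|W| = (2 ^ m)%N ->
  (forall x, \sum_a alpha x a ^+ 2 = 1) -> (forall y, \sum_a beta y a ^+ 2 = 1) ->
  0 < d -> 3 <= k%:R * d ^+ 2 ->
  (forall x y, let mu := (1 - (\sum_a alpha x a * beta y a) ^+ 2) / 2 in
    if f x y then mu + d <= tau else tau + d <= mu) ->
  exists S : smp_protocol n, [/\ smp_valid S, computes f (smp_acc S) &
    smp_cost S = (m * k + m * k)%N].
Proof.
move=> cardW al1 be1 d0 kd hf.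
have [t [h [t1 th]]] := swap_diagonalization RR W.
pose MW : finType := {ffun 'I_k -> W}.
have cardM : #|MW| = (2 ^ (m * k))%N by rewrite card_ffun card_ord cardW expnM.
(* The [i]th copy of Alice is paired with the [i]th copy of Bob; [un] below inverts this
   regrouping. *)
pose at_ (z : MW * MW) i := (z.1 i, z.2 i).
pose T (z w : MW * MW) := \prod_i t (at_ z i) (at_ w i).
pose g (z : MW * MW) := \sum_i (h (at_ z i))%:R <= k%:R * tau.
pose un (p : {ffun 'I_k -> W * W}) : MW * MW := ([ffun i => (p i).1], [ffun i => (p i).2]).
have atK p i : at_ (un p) i = p i by rewrite /at_ !ffunE; case: (p i).
have sum_un (P : pred (MW * MW)) (F : MW * MW -> RR) : \sum_(z | P z) F z = \sum_(p | P (un p)) F (un p).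
  rewrite (reindex un) //; exists (fun z => [ffun i => at_ z i]) => [p|[z z']] _.
    by apply/ffunP => i; rewrite ffunE atK.
  by congr (_, _); apply/ffunP => i; rewrite !ffunE.
have prod_sum (F : 'I_k -> W * W -> RR) : \sum_z \prod_i F i (at_ z i) = \prod_i \sum_a F i a.
  rewrite sum_un bigA_distr_bigA; apply: eq_bigr => p _.
  by apply: eq_bigr => i _; rewrite atK.
have unit_prod (u : W -> RR) : \sum_a u a ^+ 2 = 1 -> \sum_(p : MW) (\prod_i u (p i)) ^+ 2 = 1.
  move=> u1; under eq_bigr do rewrite -prodrXl.
  by rewrite -(bigA_distr_bigA (fun _ a => u a ^+ 2)) big1.
have [|||S [Sv Sc Sa]] := @smp_of_measurement n MW MW (m * k) (m * k)
  (fun x p => \prod_i alpha x (p i)) (fun y p => \prod_i beta y (p i)) T g cardM cardM.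
- by move=> x; apply: unit_prod.
- by move=> y; apply: unit_prod.
- move=> w w'; under eq_bigr do rewrite -big_split /=.
  rewrite (prod_sum (fun i z => t z (at_ w i) * t z (at_ w' i))).
  under eq_bigr do rewrite t1.
  case: eqVneq => [->|ne]; first by rewrite big1 // => i _; rewrite eqxx.
  have [i hi] : exists i, at_ w i != at_ w' i.
    apply/existsP; apply: contraNT ne; rewrite negb_exists => /forallP e.
    have e' i : at_ w i = at_ w' i by apply/eqP; have := e i; rewrite negbK.
    by case: w w' e' {e} => [p q] [p' q'] e'; apply/eqP; congr (_, _);
      apply/ffunP => i; have [] := e' i.
  by rewrite (bigD1 i) //= (negPf hi) mul0r.
exists S; split=> //.
rewrite (toC_computes _ Sa) => x y.
pose v (w : W * W) := alpha x w.1 * beta y w.2.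
pose r z := (\sum_w t z w * v w) ^+ 2.
set mu := (1 - (\sum_a alpha x a * beta y a) ^+ 2) / 2.
have r0 z : 0 <= r z by apply: sqr_ge0.
have r1 : \sum_z r z = 1.
  rewrite /r isometry_sumsq // -(pair_bigA _ (fun a b => (alpha x a * beta y b) ^+ 2)) /=.
  rewrite -(al1 x); apply: eq_bigr => a _.
  by under eq_bigr do rewrite exprMn; rewrite -mulr_sumr be1 mulr1.
have rh : \sum_(z | h z) r z = mu by apply: th.
have [accept reject] := count_concentration tau r0 r1 rh d0 kd.
have PE : \sum_(z | g z) (\sum_w T z w * (\prod_i alpha x (w.1 i) * \prod_i beta y (w.2 i))) ^+ 2 =
    \sum_(p : {ffun 'I_k -> W * W} | \sum_i (h (p i))%:R <= k%:R * tau) \prod_i r (p i).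
  rewrite sum_un; apply: eq_big => [p|p _].
    by rewrite /g; under eq_bigr do rewrite atK.
  rewrite /r prodrXl; congr (_ ^+ 2).
  rewrite -(prod_sum (fun i w => t (p i) w * v w)); apply: eq_bigr => w _.
  rewrite /T -!big_split /=; apply: eq_bigr => i _.
  by rewrite atK.
move: accept reject; rewrite /= -PE => accept reject.
by have := hf x y; rewrite -/mu /=; case: (f x y) => [/accept|/reject].
Qed.

(* The entry [1/2] puts both vectors in a cone where the squared overlap, which is what
   the swap test measures, is monotone in the inner product; the last two coordinates,
   one for each party, only serve to normalize. *)
Lemma fingerprint_vectors (X Y : Type) (D : nat) (a : X -> 'I_D -> RR) (b : Y -> 'I_D -> RR) :
  (0 < D)%N -> (forall x, \sum_i a x i ^+ 2 <= 2) -> (forall y, \sum_i b y i ^+ 2 <= 2) ->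
  exists (alpha : X -> bool * bool * 'I_D -> RR) (beta : Y -> bool * bool * 'I_D -> RR),
  [/\ forall x, \sum_w alpha x w ^+ 2 = 1, forall y, \sum_w beta y w ^+ 2 = 1 &
      forall x y, \sum_w alpha x w * beta y w = (1 + \sum_i a x i * b y i) / 4].
Proof.
move=> D0 a2 b2; have j0 : 'I_D := Ordinal D0.
(* The two bits select a block: the vector [u], halved, or one of three scalars [r], [s], [t] stored
   at position [j0]. *)
pose vv (u : 'I_D -> RR) (r s t : RR) (w : bool * bool * 'I_D) : RR :=
  if w.1.1 then (if w.1.2 then t else s) * (w.2 == j0)%:R
  else if w.1.2 then r * (w.2 == j0)%:R else u w.2 / 2.
have sum0 (r s : RR) : \sum_j r * (j == j0)%:R * (s * (j == j0)%:R) = r * s.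
  rewrite (bigD1 j0) //= eqxx !mulr1 big1 ?addr0 // => j /negPf->.
  by rewrite !mulr0.
have vvE u r s t u' r' s' t' : \sum_w vv u r s t w * vv u' r' s' t' w =
    (\sum_j u j * u' j) / 4 + r * r' + s * s' + t * t'.
  rewrite -(pair_bigA _ (fun e j => vv u r s t (e, j) * vv u' r' s' t' (e, j))) /=.
  rewrite -(pair_bigA _ (fun e e' => \sum_j vv u r s t (e, e', j) * vv u' r' s' t' (e, e', j))) /=.
  rewrite !big_bool /vv /= !sum0.
  have -> : \sum_j u j / 2 * (u' j / 2) = (\sum_j u j * u' j) / 4.
    by rewrite mulr_suml; apply: eq_bigr => j _; field.
  ring.
(* This completes the squared norm to 1; the radicand is at least [1 / 4] by the bound 2 on the
   squared norms. *)
pose fill (u : 'I_D -> RR) := Num.sqrt (3 / 4 - (\sum_j u j ^+ 2) / 4).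
have fillE (u : 'I_D -> RR) : \sum_j u j ^+ 2 <= 2 ->
    (\sum_j u j * u j) / 4 + 1 / 2 * (1 / 2) + fill u * fill u = 1.
  move=> u2; rewrite -[fill u * fill u]expr2 sqr_sqrtr; last by lra.
  by under eq_bigr do rewrite -expr2; field.
exists (fun x => vv (a x) (1 / 2) (fill (a x)) 0), (fun y => vv (b y) (1 / 2) 0 (fill (b y))).
split=> [x|y|x y].
- by under eq_bigr do rewrite expr2; rewrite vvE mulr0 addr0 fillE.
- by under eq_bigr do rewrite expr2; rewrite vvE mulr0 addr0 fillE.
- by rewrite vvE; field.
Qed.

(** * Separation of the two cases, and the choice of parameters *)

(** The probability of an antisymmetric outcome for two fingerprints built from vectors with inner
    product [t]. *)
Definition swap_reject_prob (R : realFieldType) (t : R) : R := (1 - ((1 + t) / 4) ^+ 2) / 2.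

(** Here [s] is an acceptance probability and [t] the perturbed rescaled inner product. Even after
    the error [G / 16], [t] stays at distance [5 / 48 * G] from the midpoint [G / 2], and the
    difference of the squares factors as this gap times a sum bounded below. *)
Lemma swap_reject_prob_gap (R : realFieldType) (G s t : R) :
  0 < G <= 1 -> 0 <= s -> `|t - s * G| <= G / 16 ->
  (2 / 3 <= s -> swap_reject_prob t + G / 512 <= swap_reject_prob (G / 2)) /\
  (s <= 1 / 3 -> swap_reject_prob (G / 2) + G / 512 <= swap_reject_prob t).
Proof.
move=> /andP[G0 G1] s0; rewrite ler_norml => /andP[h1 h2]; rewrite /swap_reject_prob.
have sG0 : 0 <= s * G by rewrite mulr_ge0 // ltW.
split=> hs.
- have hs' : 2 / 3 * G <= s * G by rewrite ler_pM2r.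
  have : 0 <= (t - G / 2 - 5 / 48 * G) * (2 + t + G / 2) by rewrite mulr_ge0; lra.
  have : 0 <= G * (t + G / 2) by rewrite mulr_ge0; lra.
  lra.
- have hs' : s * G <= 1 / 3 * G by rewrite ler_pM2r.
  have : 0 <= (G / 2 - t - 5 / 48 * G) * (2 + t + G / 2) by rewrite mulr_ge0; lra.
  have : 0 <= G * (1 + t + G / 2) by rewrite mulr_ge0; lra.
  lra.
Qed.

Lemma ln_ge_half_log (j n : nat) : (2 ^ j <= n)%N -> j%:R / 2 <= Rpower.ln n%:R :> RR.
Proof.
move=> jn; have pow0 i : 0 < 2 ^+ i :> RR by rewrite exprn_gt0.
apply: (@le_trans _ _ (Rpower.ln (2 ^+ j))); last first.
  have : 2 ^+ j <= n%:R :> RR by rewrite -natrX ler_nat.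
  rewrite le_eqVlt => /orP[/eqP->//|/RltP h].
  by apply/RleP/RIneq.Rlt_le/Rpower.ln_increasing => //; apply/RltP.
elim: j {jn} => [|j IH]; first by rewrite mul0r expr0 Rpower.ln_1.
have -> : Rpower.ln (2 ^+ j.+1 : RR) = (Rpower.ln (2 : RR) : RR) + Rpower.ln (2 ^+ j : RR).
  by rewrite exprS; apply: Rpower.ln_mult; apply/RltP.
have ln2 : 1 / 2 <= Rpower.ln (2 : RR) :> RR.
  by rewrite div1r; apply/RleP/RIneq.Rlt_le/Rpower.ln_lt_2.
by rewrite -[j.+1]add1n natrD mulrDl lerD.
Qed.

(** Since [q + 1 <= 2 ^ q], the message length is at most [82 * 2 ^ q * ln n], so the cost is at
    most [164 * 2 ^ 20 * 2 ^ (5 * q) * ln n]. The constant is rounded up to [2 ^ 28] and the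
    exponent to [8 * c]. *)
Lemma cost_bound (n q c L : nat) : (2 <= n)%N -> (2 ^ L <= n)%N -> (q <= c)%N ->
  (let m := 12 * q + 40 + L in m * 2 ^ (20 + 4 * q) + m * 2 ^ (20 + 4 * q))%N%:R
    <= 2 ^+ 28 * 2 ^+ (8 * c) * Rpower.ln n%:R :> RR.
Proof.
move=> n2 Ln qc /=; set l : RR := Rpower.ln n%:R.
have hl : 1 / 2 <= l by apply: (ln_ge_half_log (j := 1)).
have hL : L%:R / 2 <= l by apply: ln_ge_half_log.
have hq : (q.+1 <= 2 ^ q)%N by apply: ltn_expl.
set g : RR := 2 ^+ q; have g1 : q%:R + 1 <= g by rewrite natr1 /g -natrX ler_nat.
have q0 : 0 <= q%:R :> RR by [].
have m_le : (12 * q + 40 + L)%N%:R <= 82 * (g * l).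
  rewrite (_ : _%:R = 12 * q%:R + 40 + L%:R); last by rewrite natrD natrD natrM.
  have : 1 / 2 * g <= l * g by rewrite ler_wpM2r //; lra.
  have : 1 * l <= g * l by rewrite ler_wpM2r //; lra.
  lra.
have g0 : 0 < g by lra.
have -> : (2 : RR) ^+ (8 * c) = (2 ^+ c) ^+ 8 by rewrite mulnC exprM.
have gc : g ^+ 5 <= (2 ^+ c) ^+ 8.
  rewrite /g -!exprM; apply: ler_weXn2l; first by lra.
  by rewrite (leq_trans (leq_mul qc (leqnn 5))) // leq_mul.
rewrite natrD natrM natrX exprD [(4 * q)%N]mulnC exprM -/g.
apply: (@le_trans _ _ (2 * (82 * (g * l) * (2 ^+ 20 * g ^+ 4)))).
  have : (12 * q + 40 + L)%N%:R * (2 ^+ 20 * g ^+ 4) <= 82 * (g * l) * (2 ^+ 20 * g ^+ 4).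
    by rewrite ler_wpM2r // mulr_ge0 // exprn_ge0 // ltW.
  lra.
have l0 : 0 <= l by lra.
have : g ^+ 5 * l <= (2 ^+ c) ^+ 8 * l by rewrite ler_wpM2r.
have : 0 <= g ^+ 5 * l by rewrite mulr_ge0 // exprn_ge0 // ltW.
rewrite (_ : 2 * (82 * (g * l) * (2 ^+ 20 * g ^+ 4)) = 164 * 2 ^+ 20 * (g ^+ 5 * l)); last by ring.
rewrite (_ : 2 ^+ 28 = 256 * 2 ^+ 20 :> RR); last by rewrite -[28%N]/(8 + 20)%N exprD; congr (_ * _); ring.
have : 0 < 2 ^+ 20 :> RR by rewrite exprn_gt0.
set e : RR := 2 ^+ 20; move=> e0 h1 h2; rewrite -!mulrA [256 * _]mulrCA [164 * _]mulrCA ler_pM2l //.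
lra.
Qed.

Theorem theorem4 :
  exists C : RR, 0 < C /\
    forall (n : nat), (2 <= n)%N ->
    forall (f : input n -> input n -> bool) (c : nat),
      Qent_le f c ->
      Qpar_le f (C * 2%:R ^+ (8 * c) * Rpower.ln n%:R).
Proof.
exists (2 ^+ 28); split=> [|n n2 f c [P [Pv Pf Pc]]]; first by rewrite exprn_gt0.
have [d [a [b [a4 b4 acc]]]] := ent_acc_factorization Pv.
have acc_ge0 x y : 0 <= \sum_i a x i * b y i.
  rewrite -toC_le rmorph0 -acc; apply: sumr_ge0 => z _; exact: exprn_ge0.
move/(toC_computes _ acc): Pf => Pf.
set q := ent_cost P in a4 b4 Pc.
pose G : RR := 4 ^- q.
have G0 : 0 < G by rewrite /G invr_gt0 exprn_gt0.
have G01 : 0 < G <= 1.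
  by rewrite G0 /G invf_le1 ?exprn_gt0 // exprn_ege1 // ler1n.
have GE : G = (2 ^+ q)^-1 ^+ 2.
  by rewrite /G exprVn -exprM mulnC exprM; congr ((_ ^+ _)^-1); ring.
pose h : RR := 2 ^+ q; have h0 : h != 0 by rewrite expf_neq0 // pnatr_eq0.
(* Both parties' vectors form one family, as [dimension_reduction] requires. The scaling makes the
   squared norms at most 1 and multiplies the inner products by [G]. *)
pose v (z : input n + input n) (i : 'I_d) : RR :=
  (match z with inl x => a x i | inr y => b y i end) / 2 ^+ q.
have v1 z : \sum_i v z i ^+ 2 <= 1.
  under eq_bigr do rewrite exprMn -GE.
  rewrite -mulr_suml ler_pdivrMr ?exprn_gt0 // mul1r.
  by case: z => [x|y]; [apply: a4 | apply: b4].
have vE x y : \sum_i v (inl x) i * v (inr y) i = (\sum_i a x i * b y i) * G.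
  by rewrite mulr_suml; apply: eq_bigr => i _; rewrite /v mulrACA -expr2 -GE.
(* The exponent collects [G ^- 6 = 2 ^ (12 * q)], [16 ^ 6 = 2 ^ 24], [2048 = 2 ^ 11] and
   [2 * n + 3 <= 2 ^ (L + 3)]. *)
pose L := trunc_log 2 n; pose D := (2 ^ (12 * q + 38 + L))%N.
have D0 : (0 < D)%N by rewrite expn_gt0.
have eta01 : 0 < G / 16 <= 1 by move: G01; lra.
have cardF : (2 * #|{: input n + input n}| ^ 2 <= 2 ^ (2 * n + 3))%N.
  rewrite card_sum !card_ffun card_bool card_ord addnn -mul2n -expnS -expnM -expnS.
  by rewrite leq_exp2l //; lia.
have Dbig : 2048 * (2 * n + 3)%N%:R <= D%:R * (G / 16) ^+ 6.
  have -> : D%:R * (G / 16) ^+ 6 = 2048 * (8 * 2 ^+ L) :> RR.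
    rewrite /D natrX exprD exprD [(12 * q)%N]mulnC exprM GE -/h.
    by field.
  rewrite ler_pM2l // -natrX -natrM ler_nat.
  have : (n < 2 ^ L.+1)%N by apply: trunc_log_ltn.
  rewrite expnS; lia.
have [v' hv'] := dimension_reduction eta01 v1 cardF D0 Dbig.
have norm2 z : \sum_j v' z j ^+ 2 <= 2.
  have sq m (u : 'I_m -> RR) : \sum_i u i ^+ 2 = \sum_i u i * u i.
    by apply: eq_bigr => i _; rewrite expr2.
  have := v1 z; rewrite !sq; have /ler_normlP[_] := hv' z z.
  by lra.
have [al [be [al1 be1 albe]]] := fingerprint_vectors D0 (fun x => norm2 (inl x)) (fun y => norm2 (inr y)).
(* The gap is [G / 512], so that [k * (G / 512) ^+ 2 = 4], enough for Chebyshev's inequality. *)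
pose k := (2 ^ (20 + 4 * q))%N.
have d0 : 0 < G / 512 by rewrite divr_gt0.
(* The two block bits of a fingerprint add 2 to the exponent of [D]. *)
have cardW : #|{: bool * bool * 'I_D}| = (2 ^ (12 * q + 40 + L))%N.
  have -> : (12 * q + 40 + L = (12 * q + 38 + L).+2)%N by rewrite !addnS.
  by rewrite !card_prod card_bool card_ord -mulnA -!expnS.
have kd : 3 <= k%:R * (G / 512) ^+ 2.
  rewrite /k natrX exprD [(4 * q)%N]mulnC exprM GE -/h (_ : _ * _ = 4); first by lra.
  by field.
have sep x y : let m := (1 - (\sum_w al x w * be y w) ^+ 2) / 2 in
    if f x y then m + G / 512 <= swap_reject_prob (G / 2)
    else swap_reject_prob (G / 2) + G / 512 <= m.
  rewrite albe -/(swap_reject_prob _) /=; set s := \sum_i a x i * b y i.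
  have near : `|\sum_i v' (inl x) i * v' (inr y) i - s * G| <= G / 16 by rewrite -vE hv'.
  have [hi lo] := swap_reject_prob_gap G01 (acc_ge0 x y) near.
  by have := Pf x y; case: (f x y) => [/hi|/lo].
have [S [Sv Sf Sc]] := smp_of_fingerprints cardW al1 be1 d0 kd sep.
exists S; split=> //; rewrite Sc; apply: cost_bound => //.
by rewrite trunc_logP // ltnW.
Qed.
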